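(* Let $p\in(0,2]$. The two-pass method described in the context returns a $p$-ppswor sample of size $k$ according to the frequency vector $\nu$, with the following composable sketch sizes (memory words and number of stored key strings) and success probabilities: (1) signed element values, $p<2$: $O(k\log n)$ words, $O(k)$ key strings, success probability at least $\left(1-\frac{1}{\mathrm{poly}(n)}\right)(1-3e^{-k})$; (2) signed element values, $p=2$: $O(k\log^2 n)$ words, $O(k)$ key strings, success probability at least $\left(1-\frac{1}{\mathrm{poly}(n)}\right)(1-3e^{-k})$; (3) positive element values, $p<1$: $O(k)$ words, $O(k)$ key strings, success probability at least $1-3e^{-k}$; (4) positive element values, $p=1$: $O(k\log n)$ words, $O(k)$ key strings, success probability at least $1-3e^{-k}$. The success probability is defined to be that of returning the exact top-$k$ keys by transformed frequencies $\nu^*_x$. The bound applies even when conditioned on the top-$k$ being a particular $k$-tuple.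
   Context: Data: a dataset $\mathcal E$ consists of elements $e=(e.\mathrm{key},e.\mathrm{val})$. The frequency of a key $x$ is $\nu_x=\sum_{e:\,e.\mathrm{key}=x}e.\mathrm{val}$. For a vector $v$, $v_{(i)}$ is the entry of $i$-th largest magnitude, $\mathrm{tail}_k(v)$ is $v$ with its $k$ largest-magnitude entries replaced by $0$, and $\mathrm{order}(v)$ is the permutation listing the indices by decreasing magnitude of entries. $p$-ppswor: for a vector $w$, draw i.i.d. $r_x\sim\mathrm{Exp}[1]$ (exponential, rate $1$) and set $w^*_x=w_x/r_x^{1/p}$; the distribution of $w^*$ is denoted $p\text{-ppswor}[w]$. The $p$-ppswor sample of size $k$ according to $\nu$ consists of the pairs $(x,\nu_x)$ for the $k$ keys with largest $|\nu^*_x|$, where $\nu^*_x=\nu_x/r_x^{1/p}$ are the transformed frequencies. Over the data elements the values $r_x$ are represented by a random hash of the keys. Composable sketch: a data structure supporting (i) processing a new element (computing a sketch of $\mathcal E\cup\{e\}$ from a sketch of $\mathcal E$ and $e$), (ii) merging (computing a sketch of $\mathcal E_1\cup\mathcal E_2$ from sketches of $\mathcal E_1$ and $\mathcal E_2$), and (iii) producing the desired output from the sketch. Residual heavy hitters (rHH) sketch: an $\ell_q$ $(k,\psi)$-rHH sketch of a dataset with frequency vector $v$ provides estimates $\widehat v_x$ for all keys with $\|\widehat v-v\|_\infty^q\le\frac{\psi}{k}\|\mathrm{tail}_k(v)\|_q^q$ (for randomized sketches, with some probability $1-\delta'$). Two such composable sketches are used: Counters ($q=1$, positive values), of size $O(k/\psi)$,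 and CountSketch ($q=2$, signed values), of size $O(\frac k\psi\log\frac n{\delta'})$. The parameter $\Psi$: for $\rho=q/p$, $$\Psi_{n,k,\rho}(\delta)=\sup\left\{\psi\ \Big|\ \forall w\in\mathbb R^n,\ \forall\text{ permutations }\pi\text{ of }[n]:\ \Pr_{w^*\sim p\text{-ppswor}[w]\,\mid\,\mathrm{order}(w^* )=\pi}\left[k\frac{|w^*_{(k)}|^q}{\|\mathrm{tail}_k(w^* )\|_q^q}\le\psi\right]\le\delta\right\}.$$ The two-pass method: Pass I: compute an $\ell_q$ $(k+1,\psi)$-rHH sketch $R$ of the transformed data elements $\left(\mathrm{KeyHash}(e.\mathrm{key}),\ e.\mathrm{val}/r_{e.\mathrm{key}}^{1/p}\right)$, where $\mathrm{KeyHash}$ is a hash to $[n]$ applied when keys have a large or non-integer domain, and $\psi=\frac{1}{3^q}\Psi_{n,k,\rho}(\delta)$, with $\rho=q/p$ and $\delta=3e^{-k}$ (a lower bound on $\Psi_{n,k,\rho}(3e^{-k})$ is used to set $\psi$). The sketch $R$ is CountSketch ($q=2$) in cases (1) and (2), and Counters ($q=1$) in cases (3) and (4). Pass II: let $\widehat{\nu^*_x}$ be the estimate of $\nu^*_x$ that $R$ gives for $\mathrm{KeyHash}(x)$. Using a composable top-$(Bk)$ structure $T$, collect the key strings $x$ (if needed) and the exact frequencies $\nu_x$ for the keys with the $Bk$ largest $|\widehat{\nu^*_x}|$, where $B$ is a (suitable) constant. Producing the sample: compute the exact transformed frequencies $\nu^*_x=\nu_x/r_x^{1/p}$ for the keys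 stored in $T$. The sample is the set of pairs $(x,\nu_x)$ for the top-$k$ stored keys by $\nu^*_x$ (in magnitude), together with the threshold $\tau$, the $(k+1)$-st largest $\nu^*_x$ over stored keys.
   Formalization: KeyHash is assumed to have no collisions on the keys of the dataset; with a colliding hash (e.g. a constant one and many keys of equal frequency) all estimates coincide and the stated success probability fails. *)

(* Defs.v *)
From HB Require Import structures.
From mathcomp Require Import all_boot all_order all_algebra perm.
From mathcomp Require Import all_classical all_reals all_analysis.

Set Implicit Arguments.
Unset Strict Implicit.
Unset Printing Implicit Defensive.

Import Order.TTheory GRing.Theory Num.Theory.
Import numFieldNormedType.Exports.

Local Open Scope classical_set_scope.
Local Open Scope ring_scope.

(** ** Vectors indexed by [n], written as functions ['I_n -> R] *)

Section vectors.
Context {R : realType} {n : nat}.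
Implicit Types v : 'I_n -> R.

(* [sort] is stable, so that ties in magnitude are broken by index. *)
Definition order v : seq 'I_n :=
  sort (fun i j => `|v j| <= `|v i|) (enum 'I_n).

(* v_(i), for i = 1, ..., n; it is 0 for i > n. *)
Definition entry v (i : nat) : R := nth 0 [seq v j | j <- order v] i.-1.

Definition tail (k : nat) v : 'I_n -> R :=
  fun i => if i \in take k (order v) then 0 else v i.

(* the q-th power of the l_q norm *)
Definition lq_pow (q : nat) v : R := \sum_(i < n) `|v i| ^+ q.

Definition linf v : R := \big[Num.max/0]_(i < n) `|v i|.

(* k |v_(k)|^q / ||tail_k(v)||_q^q, which is +oo (even if v_(k) = 0) when the
   tail vanishes: any estimate within the rHH error bound is then exact. *)
Definition rhh_ratio (q k : nat) v : \bar R :=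
  if lq_pow q (tail k v) == 0 then +oo%E
  else (k%:R * `|entry v k| ^+ q / lq_pow q (tail k v))%:E.

End vectors.

(** ** Probability *)

Section probability.
Context {R : realType}.

(* The value is 0 when [mu B = 0]. *)
Definition cprob d (T : measurableType d) (mu : set T -> \bar R)
  (A B : set T) : R := fine (mu (A `&` B)) / fine (mu B).

Definition iid_exp1 d (T : measurableType d) (P : probability T R)
    (K : eqType) (r : K -> {RV P >-> R}) : Prop :=
  (forall x (A : set R), measurable A ->
     distribution P (r x) A = exponential_prob 1 A) /\
  (forall (s : seq K) (A : K -> set R), uniq s ->
     (forall x, measurable (A x)) ->
     P (\big[setI/setT]_(x <- s) (r x @^-1` A x))
     = (\prod_(x <- s) P (r x @^-1` A x))%E).

(* The transformation w_x |-> w_x / r_x^{1/p}. *)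
Definition transform (K : Type) (p : R) (w r : K -> R) : K -> R :=
  fun x => w x / r x `^ p^-1.

(* Psi_{n,k,rho}(delta) with rho = q/p. The law p-ppswor[w] is given by its
   realizations on arbitrary probability spaces: only the joint law of r
   matters. Permutations pi that are almost surely not the order impose
   no constraint. The supremum is taken in \bar R, since it is +oo for
   delta >= 1 or k >= n. *)
Definition Psi (p : R) (q n k : nat) (delta : R) : \bar R :=
  ereal_sup [set psi%:E | psi in [set psi : R |
    forall (w : 'I_n -> R) (pi : {perm 'I_n})
      (d : measure_display) (T : measurableType d) (P : probability T R)
      (r : 'I_n -> {RV P >-> R}), iid_exp1 r ->
    let wstar omega := transform p w (fun i => r i omega) in
    cprob P [set omega | (rhh_ratio q k (wstar omega) <= psi%:E)%E]
            [set omega | order (wstar omega) = codom pi] <= delta]].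

End probability.

(** ** Composable sketches *)

Record sketch (E S : Type) := Sketch {
  sk_empty : S ;
  sk_add : S -> E -> S ;
  sk_merge : S -> S -> S ;
  sk_words : S -> nat }.

(* The ways in which a dataset can be assembled by processing elements and
   merging. A sketch of a dataset is what any such assembly returns; it need
   not be a function of the dataset alone. *)
Inductive assembly (E : Type) :=
  | AEmpty
  | AAdd of assembly E & E
  | AMerge of assembly E & assembly E.
Arguments AEmpty {E}.

Fixpoint elements E (t : assembly E) : seq E :=
  match t with
  | AEmpty => [::]
  | AAdd t e => rcons (elements t) e
  | AMerge t1 t2 => elements t1 ++ elements t2
  end.

Fixpoint amap E F (f : E -> F) (t : assembly E) : assembly F :=
  match t with
  | AEmpty => AEmpty
  | AAdd t e => AAdd (amap f t) (f e)
  | AMerge t1 t2 => AMerge (amap f t1) (amap f t2)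
  end.

Fixpoint run E S (sk : sketch E S) (t : assembly E) : S :=
  match t with
  | AEmpty => sk_empty sk
  | AAdd t e => sk_add sk (run sk t) e
  | AMerge t1 t2 => sk_merge sk (run sk t1) (run sk t2)
  end.

(* A dataset is a sequence of pairs e = (e.key, e.val). *)
Definition freq (R : realType) (K : eqType) (E : seq (K * R)) (x : K) : R :=
  \sum_(e <- E | e.1 == x) e.2.

(** *** Residual heavy hitters sketches *)

(* Randomized composable sketches that estimate the frequencies of keys in
   [n]; the seed is the internal randomness (e.g. the hash functions), shared
   by all the sketches to be merged. *)
Record est_sketch (R : realType) (n : nat) := EstSketch {
  seed_display : measure_display ;
  seed : measurableType seed_display ;
  seedP : probability seed R ;
  es_state : Type ;
  es_sketch : seed -> sketch ('I_n * R) es_state ;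
  es_est : seed -> es_state -> 'I_n -> R }.

Section rhh.
Context {R : realType} {n : nat}.
Implicit Types A : est_sketch R n.

Definition estimate A (theta : seed A) (t : assembly ('I_n * R)) : 'I_n -> R :=
  es_est theta (run (es_sketch theta) t).

(* The estimates are jointly measurable in the seed and the element values, so
   that they are random variables when the values are random. *)
Definition measurable_estimates A : Prop :=
  forall (d : measure_display) (T : measurableType d)
    (t : assembly ('I_n * {mfun T >-> R})) (i : 'I_n),
  measurable_fun [set: T * seed A]
    (fun z => estimate z.2
       (amap (fun e : 'I_n * {mfun T >-> R} => (e.1, e.2 z.1)) t) i).

(* With [positive], the guarantee is restricted to positive element values. *)
Definition is_rHH (positive : bool) (q k : nat) (psi delta : R) A : Prop :=
  measurable_estimates A /\
  forall t : assembly ('I_n * R),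
    (positive -> forall e, e \in elements t -> 0 < e.2) ->
    let v := freq (elements t) in
    let accurate := [set theta |
      linf (fun i => estimate theta t i - v i) ^+ q
        <= psi / k%:R * lq_pow q (tail k v)] in
    ((1 - delta)%:E <= seedP A accurate)%E.

Definition es_words A (theta : seed A) (t : assembly ('I_n * R)) : nat :=
  sk_words (es_sketch theta) (run (es_sketch theta) t).

(* CountSketch and Counters enter through their guarantees and sizes; [C0] is
   the constant hidden in the O() that bounds the size. *)
Definition is_CountSketch (C0 : R) (k : nat) (psi delta : R) A : Prop :=
  is_rHH false 2 k psi delta A /\
  forall (theta : seed A) t,
    (es_words theta t)%:R <= C0 * (k%:R / psi * ln (n%:R / delta)) :> R.

Definition is_Counters (C0 : R) (k : nat) (psi : R) A : Prop :=
  is_rHH true 1 k psi 0 A /\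
  forall (theta : seed A) t, (es_words theta t)%:R <= C0 * (k%:R / psi) :> R.

End rhh.

(** *** The composable top-m structure *)

(* It keeps the m keys of highest priority and their frequencies. The priority
   is fixed; its ties are broken by [h], so that an evicted key never comes
   back and the stored frequencies are exact. *)
Section top_structure.
Context {R : realType} {K : eqType}.
Variables (priority : K -> R) (h : K -> nat) (m : nat).

Definition top_prune (s : seq (K * R)) : seq (K * R) :=
  take m (sort (fun a b => (priority b.1 < priority a.1) ||
    (priority b.1 == priority a.1) && (h a.1 <= h b.1)%N) s).

Fixpoint top_update (s : seq (K * R)) (e : K * R) : seq (K * R) :=
  match s with
  | [::] => [:: e]
  | a :: s => if a.1 == e.1 then (a.1, a.2 + e.2) :: s else a :: top_update s e
  end.

(* One memory word per stored frequency; key strings are counted apart. *)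
Definition top_sketch : sketch (K * R) (seq (K * R)) := {|
  sk_empty := [::] ;
  sk_add := fun s e => top_prune (top_update s e) ;
  sk_merge := fun s s' => top_prune (foldl top_update s s') ;
  sk_words := size |}.

End top_structure.

(** ** The two-pass method *)

Section two_pass.
Context {R : realType} {n : nat} {K : eqType}.
Variables (p : R) (k m : nat) (KeyHash : K -> 'I_n) (A : est_sketch R n).
(* the same dataset may be assembled differently in the two passes *)
Variables (t1 t2 : assembly (K * R)).
Variables (r : K -> R) (theta : seed A).

Definition pass1_data : assembly ('I_n * R) :=
  amap (fun e => (KeyHash e.1, e.2 / r e.1 `^ p^-1)) t1.

Definition pass1_est (x : K) : R := estimate theta pass1_data (KeyHash x).

Definition pass2_sketch : sketch (K * R) (seq (K * R)) :=
  top_sketch (fun x => `|pass1_est x|) KeyHash m.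

Definition pass2 : seq (K * R) := run pass2_sketch t2.

Definition two_pass_words : nat :=
  es_words theta pass1_data + sk_words pass2_sketch pass2.

Definition two_pass_keys : nat := size pass2.

(* the sample and the threshold tau *)
Definition two_pass : seq (K * R) * R :=
  let mag (e : K * R) := `|e.2 / r e.1 `^ p^-1| in
  let s := sort (fun a b => mag b <= mag a) pass2 in
  (take k s, nth 0 [seq mag e | e <- s] k).

End two_pass.

Section ppswor_sample.
Context {R : realType} {K : eqType}.
Implicit Types (v : K -> R) (D s : seq K).

(* [s] lists k keys of [D] (all of them if there are fewer) with largest |v_x|.
   Ties, which a.s. only occur between keys of frequency 0, may be broken in
   any way. *)
Definition is_top (k : nat) D v s : Prop :=
  [/\ uniq s, {subset s <= D}, size s = minn k (size (undup D)) &
      forall x y, x \in s -> y \in D -> y \notin s -> `|v y| <= `|v x|].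

Definition is_top_tuple (k : nat) D v s : Prop :=
  is_top k D v s /\ sorted (fun x y => `|v y| <= `|v x|) s.

Definition is_ppswor_sample (p : R) (k : nat) (E : seq (K * R)) (r : K -> R)
    (S : seq (K * R)) : Prop :=
  is_top k (unzip1 E) (transform p (freq E) r) (unzip1 S) /\
  S = [seq (x, freq E x) | x <- unzip1 S].

End ppswor_sample.

(* The randomness is that of the r_x (on T) and, independently, that of the
   sketch (the seed). KeyHash does not collide on the keys of the dataset. *)
Definition two_pass_returns_ppswor (R : realType) (p : R) (positive : bool)
    (n k m : nat) (A : est_sketch R n) (words keys success : R) : Prop :=
  forall (d : measure_display) (T : measurableType d) (P : probability T R)
    (K : eqType) (r : K -> {RV P >-> R}) (KeyHash : K -> 'I_n)
    (E : seq (K * R)) (t1 t2 : assembly (K * R)),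
  iid_exp1 r ->
  {in unzip1 E &, injective KeyHash} ->
  perm_eq (elements t1) E -> perm_eq (elements t2) E ->
  (positive -> forall e, e \in E -> 0 < e.2) ->
  let r_ omega x := r x omega in
  let mu : set (T * seed A) -> \bar R := (P \x seedP A)%E in
  let returned : set (T * seed A) := [set z | is_ppswor_sample p k E (r_ z.1)
    (two_pass p k m KeyHash t1 t2 (r_ z.1) z.2).1] in
  let top_is (s : seq K) : set (T * seed A) := [set z |
    is_top_tuple k (unzip1 E) (transform p (freq E) (r_ z.1)) s] in
  [/\ forall omega theta,
        (two_pass_words (A := A) p m KeyHash t1 t2 (r_ omega) theta)%:R
          <= words,
      forall omega theta,
        (two_pass_keys (A := A) p m KeyHash t1 t2 (r_ omega) theta)%:R <= keys,
      (success%:E <= mu returned)%E &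
      forall s : seq K, mu (top_is s) != 0%E ->
        success <= cprob mu returned (top_is s)].

Section guarantees.
Context {R : realType}.
Implicit Types (p : R) (size : nat -> nat -> R).

(* [L] is the lower bound on Psi_{n,k,rho}(3 e^{-k}) that sets the accuracy
   psi = L / 3^q. Where Psi is +oo or large, psi is still at most 1. *)
Definition valid_psi p (q : nat) (L : nat -> nat -> R) : Prop :=
  forall n k : nat, (1 < n)%N -> (0 < k)%N ->
  [/\ 0 < L n k, ((L n k)%:E <= Psi p q n k (3 * expR (- k%:R)))%E &
      L n k / 3 ^+ q <= 1].

(* [size n k] is the bound on the number of words, up to the constant [C].
   The failure probability 1/poly(n) is n^{-c} for an arbitrary exponent c. *)
Definition two_pass_CountSketch p size : Prop :=
  exists (B : nat) (L : nat -> nat -> R), valid_psi p 2 L /\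
  forall c C0 : R, 0 < c -> exists C : R,
  forall (n k : nat) (A : est_sketch R n), (1 < n)%N -> (0 < k)%N ->
  is_CountSketch C0 k.+1 (L n k / 3 ^+ 2) (n%:R `^ (- c)) A ->
  two_pass_returns_ppswor p false k (B * k) A (C * size n k) (C * k%:R)
    ((1 - n%:R `^ (- c)) * (1 - 3 * expR (- k%:R))).

Definition two_pass_Counters p size : Prop :=
  exists (B : nat) (L : nat -> nat -> R), valid_psi p 1 L /\
  forall C0 : R, exists C : R,
  forall (n k : nat) (A : est_sketch R n), (1 < n)%N -> (0 < k)%N ->
  is_Counters C0 k.+1 (L n k / 3 ^+ 1) A ->
  two_pass_returns_ppswor p true k (B * k) A (C * size n k) (C * k%:R)
    (1 - 3 * expR (- k%:R)).

End guarantees.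

(* Main.v *)
(* The transformed magnitudes are |nu*_x| = a_x^(-1/p), where the
   a_x = r_x / |nu_x|^p are independent exponentials of rates |nu_x|^p. By the
   lack of memory, given the order in which the a_x occur, the spacings between
   them, multiplied by the total rate of the keys still to occur, are i.i.d.
   Exp[1]; this is used through the moment generating function of their partial
   sums S_i, computed by integrating out the last arrival. As the rates decrease,
   a_k / a_i <= S_k / S_i. Chernoff bounds give S_k <= 4 k and S_i >= i / 16 for
   all i > k, except with conditional probability 2 e^(-k), and hence
   |nu*_(i)| <= (64 k / i)^(1/p) |nu*_(k)|. Summing q-th powers bounds the tail,
   hence Psi from below: by a constant for p < q, by 1 / O(ln n) for p = q. The
   same event leaves at most 576 k keys above |nu*_(k)| / 3. As the estimates are
   within |nu*_(k)| / 3 of nu*, the top k keys are then among the 576 k keys of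
   largest estimate. *)

From HB Require Import structures.
From mathcomp Require Import all_boot all_order all_algebra perm.
From mathcomp Require Import all_classical all_reals all_analysis.
From mathcomp Require Import measurable_realfun.
From mathcomp Require Import ring lra zify.
Require Import Defs.

Set Implicit Arguments.
Unset Strict Implicit.
Unset Printing Implicit Defensive.

Import Order.TTheory GRing.Theory Num.Theory.
Import numFieldNormedType.Exports.

Local Open Scope classical_set_scope.
Local Open Scope ring_scope.

(** * Exponential integrals and independence *)

(** Conditional laws are never formed. A race event fixes the order of arrival of the keys of
    nonzero frequency, and the failure bound is proved in product form: the probability of a race
    that is not good is at most 2 e^(-k) times the probability of the race. Such inequalities add up
    over disjoint races, so they hold within every event that the order determines: a permutation as
    in [Psi], a given top-k tuple, the whole space. Keys of frequency 0 would have rate 0 and never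
    arrive; they are kept out of the race and come last in the order.

    The recovery argument does not pass through [Psi]: one good event gives both the tail bound and
    the count of large keys, so it is paid for once. The seed is independent of the r_x; the sketch
    guarantee, which concerns a fixed dataset, is applied on each section of the product space and
    then integrated.

    The output is a list produced by sorts with random comparisons. Lists get no sigma-algebra;
    measurability is obtained by freezing the value of each intermediate list. *)

Section integral_density.
Local Open Scope ereal_scope.
Context d (T : measurableType d) (R : realType).
Variables (mu nu : {measure set T -> \bar R}) (rho : T -> R).
Hypotheses (measurable_rho : measurable_fun [set: T] rho)
  (rho_ge0 : forall x, (0 <= rho x)%R)
  (nuE : forall A, measurable A -> nu A = \int[mu]_(x in A) (rho x)%:E).

Import HBNNSimple.

Let measurable_rhoE D : measurable_fun D (fun x => (rho x)%:E).
Proof. by apply/measurable_EFinP; exact: measurable_funTS. Qed.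

Let integral_density_nnsfun (f : {nnsfun T >-> R}) :
  \int[nu]_x (f x)%:E = \int[mu]_x ((f x)%:E * (rho x)%:E).
Proof.
under [LHS]eq_integral do rewrite fimfunE -fsumEFin//.
rewrite [LHS]ge0_integral_fsum//; last 2 first.
  - by move=> r; exact/measurable_EFinP/measurableT_comp.
  - by move=> n x _; rewrite EFinM nnfun_muleindic_ge0.
under [RHS]eq_integral.
  move=> x xD; rewrite fimfunE -fsumEFin// ge0_mule_fsuml; last first.
    by move=> r; rewrite EFinM nnfun_muleindic_ge0.
  over.
rewrite [RHS]ge0_integral_fsum//; last 2 first.
  - move=> r; apply: emeasurable_funM => //.
    by apply/measurable_EFinP; do 2 apply/measurableT_comp => //.
  - by move=> n x _; rewrite mule_ge0 ?lee_fin// -lee_fin EFinM nnfun_muleindic_ge0.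
apply: eq_fsbigr => r _.
rewrite integralZl_indic_nnsfun//= integral_indic// setIT.
have [->|r0] := eqVneq r 0%R.
  by rewrite mul0e integral0_eq// => x _; rewrite mul0r mul0e.
have [rlt|rge] := ltP r 0%R.
  rewrite preimage_nnfun0// indic0 [nu _]measure0 mule0 integral0_eq// => x _.
  by rewrite mulr0 mul0e.
rewrite nuE// integral_mkcond -ge0_integralZl//.
- apply: eq_integral => x _; rewrite patchE EFinM indicE.
  by case: ifPn => _; rewrite ?mule1 ?mule0 ?mul0e.
- by apply/(measurable_restrictT _ _).1 => //; exact: measurable_rhoE.
- by move=> x _; rewrite patchE; case: ifP => //; rewrite lee_fin.
Qed.

(** Simple functions, then monotone convergence. The density is only assumed through the values of
    [nu] on measurable sets, which is the form in which the exponential law of each r_x is given. *)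
Lemma ge0_integral_density (f : T -> \bar R) :
  measurable_fun [set: T] f -> (forall x, 0 <= f x) ->
  \int[nu]_x f x = \int[mu]_x (f x * (rho x)%:E).
Proof.
move=> mf f0.
pose f_ := nnsfun_approx measurableT mf.
transitivity (lim (\int[nu]_x (f_ n x)%:E @[n --> \oo])).
  rewrite -monotone_convergence//=.
  - apply: eq_integral => ? /[!inE] xD; apply/esym/cvg_lim => //=.
    exact: cvg_nnsfun_approx.
  - by move=> n; exact/measurable_EFinP/measurable_funTS.
  - by move=> n ? _; rewrite lee_fin.
  - by move=> ? _ ? ? mn; rewrite lee_fin; exact/lefP/nd_nnsfun_approx.
transitivity (lim (\int[mu]_x ((f_ n x)%:E * (rho x)%:E) @[n --> \oo])).
  by apply: congr_lim; apply/funext => n /=; exact: integral_density_nnsfun.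
rewrite -monotone_convergence//=.
- apply: eq_integral => x /[!inE] xD; apply/cvg_lim => //=.
  by apply: cvgeZr => //; exact: cvg_nnsfun_approx.
- by move=> n; apply: emeasurable_funM => //; exact/measurable_EFinP/measurable_funTS.
- by move=> n x _; rewrite mule_ge0// lee_fin.
- move=> x _ m n mn; apply: lee_wpmul2r; first by rewrite lee_fin.
  by rewrite lee_fin; exact/lefP/nd_nnsfun_approx.
Qed.

End integral_density.

Section exponential.
Context {R : realType}.
Notation mu := (@lebesgue_measure R).

Lemma integral_expRNZ_itvcy (a c : R) : 0 < a ->
  (\int[mu]_(x in `[c, +oo[) (expR (- a * x))%:E = (expR (- a * c) / a)%:E)%E.
Proof.
move=> a0.
have cexp (b : R) : continuous (fun z : R^o => expR (b * z)).
  move=> z; apply: continuous_comp; last exact: continuous_expR.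
  by apply: continuousM => //; exact: cst_continuous.
rewrite (@ge0_continuous_FTC2y _ _ (fun x => - (expR (- a * x) / a)) c 0).
- by rewrite -EFinB sub0r opprK.
- by move=> x _; exact: expR_ge0.
- by apply: continuous_subspaceT => x; exact: cexp.
- rewrite -[X in _ --> X]oppr0; apply: cvgN; rewrite -(mul0r a^-1).
  apply: cvgMl.
  rewrite (_ : (fun x => expR (- a * x)) =
               (fun z => expR (- z)) \o (fun z => a * z)); last first.
    by apply: eq_fun => x; rewrite mulNr.
  apply: (@cvg_comp _ _ _ _ _ _ (pinfty_nbhs R)); last exact: cvgr_expR.
  exact: gt0_cvgMry.
- by move=> x _; exact: ex_derive.
- apply: cvgN; apply: cvgMl; apply/cvg_at_right_filter; exact: cexp.
- move=> x _.
  rewrite derive1E derive_val /GRing.scale/= mulr0 add0r mulr1.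
  by rewrite mulrCA mulrN mulVf ?gt_eqF// mulrN1 opprK.
Qed.

Lemma measurable_natr_bool d (T : measurableType d) (b : T -> bool) :
  measurable_fun [set: T] b -> measurable_fun [set: T] (fun x => (b x)%:R : R).
Proof.
move=> mb; rewrite (_ : (fun x => _) = (fun x => if b x then 1 else 0 : R)).
  exact: measurable_fun_ifT.
by apply/funext => x; case: (b x).
Qed.

(** The integral over one arrival, given that it comes after [c]. Negative [kappa] is allowed
    because the upper tail bound uses a negative tilt. *)
Lemma integral_exponential_tail (c kappa : R) (nu : probability R R) :
  (forall A : set R, measurable A -> nu A = exponential_prob 1 A) ->
  0 <= c -> 0 < 1 + kappa ->
  (\int[nu]_u ((c < u)%R%:R * expR (- kappa * u))%:E =
   (expR (- (1 + kappa) * c) / (1 + kappa))%:E)%E.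
Proof.
move=> nuE c0 k0.
have mf : measurable_fun [set: R] (fun u => (c < u)%R%:R * expR (- kappa * u)).
  apply: measurable_funM.
    exact/measurable_natr_bool/measurable_fun_ltr.
 by apply: measurableT_comp => //; exact: mulrl_measurable.
(* The law is transported along the identity to [measurableTypeR R], the type that carries the
   Lebesgue measure. *)
have mid : measurable_fun [set: R] (idfun : R -> measurableTypeR R).
  by move=> _ B mB; rewrite setTI preimage_id.
pose nu' : {measure set (measurableTypeR R) -> \bar R} :=
  measure_function_pushforward__canonical__measure_function_Measure nu mid.
transitivity (\int[nu']_u ((c < u)%R%:R * expR (- kappa * u))%:E)%E.
  by rewrite ge0_integral_pushforward//=; exact/measurable_EFinP.
rewrite [LHS](@ge0_integral_density _ _ _ mu nu' (exponential_pdf 1) _ _ _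
  (fun u => ((c < u)%R%:R * expR (- kappa * u))%:E)).
- rewrite -integral_expRNZ_itvcy//.
  rewrite -integral_itv_obnd_cbnd; last first.
    apply/measurable_EFinP/measurable_funTS => /=.
    by apply: measurableT_comp => //; exact: mulrl_measurable.
  rewrite [RHS]integral_mkcond; apply: eq_integral => x _.
  rewrite patchE; case: ifPn => /=.
    rewrite inE/= in_itv/= andbT => cx.
    rewrite exponential_pdfE ?(le_trans c0) ?ltW// cx !mul1r -EFinM -expRD.
    congr (expR _)%:E; ring.
  by rewrite notin_setE/= in_itv/= andbT => /negP/negbTE ->; rewrite mul0r mul0e.
- exact: measurable_exponential_pdf.
- by move=> x; rewrite exponential_pdf_ge0.
- exact: nuE.
- exact/measurable_EFinP.
- by move=> x; rewrite lee_fin mulr_ge0 ?expR_ge0.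
Qed.

End exponential.

(** * Integrating out one of the independent variables *)

Section independence.
Context {R : realType} d (T : measurableType d) (P : probability T R).
Context (K : eqType) (r : K -> {RV P >-> R}).
Hypothesis iid : iid_exp1 r.
Local Open Scope ereal_scope.

(** Cylinder events of the variables listed in [s]: a pi-system that generates their joint
    sigma-algebra. [Tb s] is [T] with this coarser sigma-algebra. *)
Let boxes (s : seq K) : set (set T) :=
  [set A | exists2 B : K -> set R, (forall x, measurable (B x)) &
     A = \big[setI/setT]_(x <- s) (r x @^-1` B x)].

Let boxes_setI s : setI_closed (boxes s).
Proof.
move=> _ _ [B mB ->] [C mC ->]; exists (fun x => B x `&` C x).
  by move=> x; exact: measurableI.
by rewrite -big_split; apply: eq_bigr => x _; rewrite preimage_setI.
Qed.

Let boxesT s : boxes s setT.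
Proof.
by exists (fun=> setT) => //; rewrite big1.
Qed.

Let measurable_boxes s : boxes s `<=` measurable.
Proof.
move=> _ [B mB ->]; apply: bigsetI_measurable => x _.
by rewrite -[X in measurable X]setTI; exact: measurable_funP.
Qed.

Let Tb s : measurableType _ := g_sigma_algebraType (boxes s).

Let measurable_Tb s (A : set T) : @measurable _ (Tb s) A -> measurable A.
Proof.
by apply: smallest_sub; [exact: sigma_algebra_measurable|exact: measurable_boxes].
Qed.

Let measurable_idTb s : measurable_fun [set: T] (idfun : T -> Tb s).
Proof. by move=> _ A mA; rewrite setTI; exact: measurable_Tb mA. Qed.

Let idTb_mixin s := isMeasurableFun.Build _ _ _ _ _ (@measurable_idTb s).
Let idTb s : {mfun T >-> Tb s} := HB.pack (idfun : T -> Tb s) (idTb_mixin s).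
Let PTb s : probability (Tb s) R := distribution P (idTb s).

(** Both sides are finite measures in [A] that agree on the pi-system [boxes s], hence on the
    sigma-algebra it generates. *)
Let indep_g_sigma (s : seq K) (y : K) (A : set T) (C : set R) :
  uniq (y :: s) -> @measurable _ (Tb s) A -> measurable C ->
  P (A `&` r y @^-1` C) = P A * P (r y @^-1` C).
Proof.
move=> ys mA mC.
have mD : measurable (r y @^-1` C).
  by rewrite -[X in measurable X]setTI; exact: measurable_funP.
pose m1 : {measure set (Tb s) -> \bar R} :=
  measure_function_pushforward__canonical__measure_function_Measure
   (mrestr P mD) (@measurable_idTb s).
have pC : (0 <= fine (P (r y @^-1` C)))%R by exact: fine_ge0.
pose m2 : {measure set (Tb s) -> \bar R} := mscale (NngNum pC) (PTb s).
have m1E X : m1 X = P (X `&` r y @^-1` C) by [].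
have m2E X : m2 X = P X * P (r y @^-1` C).
  by rewrite muleC -[in RHS](fineK (fin_num_measure P _ mD)).
rewrite -m1E -m2E.
apply: (@measure_unique _ R (Tb s) (boxes s) (fun=> setT) erefl
  (@boxes_setI s) (fun=> boxesT s) _ m1 m2 _ _ A mA).
- by rewrite bigcup_const.
- move=> _ [B mB ->].
  rewrite m1E m2E.
  have [_ ind] := iid.
  (* Setting the family to [C] at [y] does not change the box, as [y] is not in [s]; the product
     formula for [y :: s] then applies. *)
  pose B' x := if x == y then C else B x.
  have mB' x : measurable (B' x) by rewrite /B'; case: ifP.
  have eB' : \big[setI/setT]_(x <- s) (r x @^-1` B x) =
    \big[setI/setT]_(x <- s) (r x @^-1` B' x).
    rewrite !big_seq; apply: eq_bigr => x xs; rewrite /B' ifN//.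
    by apply: contraTneq xs => ->; case/andP: ys.
  have := ind (y :: s) B' ys mB'; rewrite !big_cons -eB'.
  rewrite {1 2}/B' eqxx setIC => ->; rewrite muleC; congr (_ * _).
  rewrite -ind//; last by case/andP: ys.
  by rewrite eB'.
- by move=> _; rewrite m1E (le_lt_trans (probability_le1 _ _))// ?ltry//; exact: measurableI.
Qed.

(* The function [h] of the values [r x], for [x] in [s], and of one more real
   is required to be measurable in every measurable reparametrization. *)
Lemma integral_indep (s : seq K) (y : K) (h : (K -> R) -> R -> R) :
  uniq (y :: s) ->
  (forall rho u, (0 <= h rho u)%R) ->
  (forall d' (Z : measurableType d') (f : K -> Z -> R) (g : Z -> R),
    (forall x, x \in s -> measurable_fun [set: Z] (f x)) ->
    measurable_fun [set: Z] g ->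
    measurable_fun [set: Z] (fun z => h (f ^~ z) (g z))) ->
  \int[P]_t (h (r ^~ t) (r y t))%:E =
  \int[P]_t \int[distribution P (r y)]_u (h (r ^~ t) u)%:E.
Proof.
move=> ys h0 mh.
have mrTb x : x \in s -> measurable_fun [set: Tb s] (r x : Tb s -> R).
  move=> xs _ C mC; rewrite setTI; apply: sub_sigma_algebra.
  exists (fun z => if z == x then C else setT) => [z|]; first by case: ifP.
  rewrite (bigD1_seq x)//=; last by case/andP: ys.
  rewrite eqxx big1 ?setIT// => z /negbTE ->.
  by rewrite preimage_setT.
have mphi : measurable_fun [set: T] (fun t => (t, r y t) : Tb s * R).
  exact: measurable_fun_pair.
(* The joint law of the identity into [Tb s] and of [r y] is the product of its marginals, so
   Tonelli gives the iterated integral. *)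
pose m' : {measure set (Tb s * R) -> \bar R} :=
  measure_function_pushforward__canonical__measure_function_Measure P mphi.
pose f (z : Tb s * R) := (h (r ^~ z.1) z.2)%:E.
have mf : measurable_fun [set: Tb s * R] f.
  apply/measurable_EFinP.
  apply: (mh _ (Tb s * R)%type (fun x z => r x z.1) snd) => // x xs.
  by apply: (measurableT_comp (mrTb _ xs)).
have f0 z : 0 <= f z by rewrite lee_fin.
transitivity (\int[m']_z f z).
  by rewrite ge0_integral_pushforward.
transitivity (\int[PTb s \x distribution P (r y)]_z f z).
  apply: eq_measure_integral => /= X mX _; apply/esym.
  apply: product_measure_unique => // A B mA mB.
  by rewrite -(@indep_g_sigma s y A B).
rewrite fubini_tonelli1//.
rewrite ge0_integral_pushforward//.
- exact: measurable_fun_fubini_tonelli_F.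
- by move=> x _; apply: integral_ge0 => u _; exact: f0.
Qed.
End independence.

(** * Conditional law of the spacings given the order *)

Section race.
Context {R : realType} {K : eqType}.
Variable lam : K -> R.
Implicit Types (rho : K -> R) (s : seq K).

(* Keys are listed from the last arrival to the first; the arrival time of [x] is
   [rho x / lam x]. *)
Definition arrival rho s : R := if s is x :: _ then rho x / lam x else 0.

(** As [arrival] is 0 on the empty list, a race also forces the first arrival, hence all of them, to
    be positive. *)
Fixpoint race rho s : bool :=
  if s is x :: s' then (arrival rho s' < rho x / lam x) && race rho s' else true.

(* Sum of the first [i] spacings, each multiplied by the total rate of the keys
   still to arrive; [d] is the rate of the keys arriving after all of [s]. *)
Fixpoint spacing_sum (i : nat) rho (d : R) s : R :=
  if s is x :: s' then
    (size s' < i)%N%:R * ((lam x + d) * (rho x / lam x - arrival rho s')) +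
    spacing_sum i rho (lam x + d) s'
  else 0.

(* The probability of [race] when [d = 0], and the integral of
   [expR (- d * arrival rho s)] over [race] in general. *)
Fixpoint race_mass (d : R) s : R :=
  if s is x :: s' then lam x / (lam x + d) * race_mass (lam x + d) s' else 1.

(** For [d = 0], the integrand of the moment generating function of the spacing sum at [- tau],
    restricted to one order. The term [d * arrival rho s] is what the later arrivals leave behind
    once they are integrated out. *)
Definition race_tilt tau i rho d s : R :=
  (race rho s)%:R * expR (- (tau * spacing_sum i rho d s + d * arrival rho s)).

Lemma race_arrival_ge0 rho s : race rho s -> 0 <= arrival rho s.
Proof. by elim: s => //= x s IH /andP[lt /IH le]; exact: le_trans (ltW lt). Qed.

Section measurability.
Context d' (Z : measurableType d') (f : K -> Z -> R).

Lemma measurable_arrival s : (forall x, x \in s -> measurable_fun [set: Z] (f x)) ->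
  measurable_fun [set: Z] (fun z => arrival (f ^~ z) s).
Proof.
case: s => [|x s] mf /=; first exact: measurable_cst.
by apply: measurable_funM => //; apply: mf; rewrite mem_head.
Qed.

Lemma measurable_race s : (forall x, x \in s -> measurable_fun [set: Z] (f x)) ->
  measurable_fun [set: Z] (fun z => race (f ^~ z) s).
Proof.
elim: s => [|x s IH] mf /=; first exact: measurable_cst.
have mf' y : y \in s -> measurable_fun [set: Z] (f y).
  by move=> ys; apply: mf; rewrite inE ys orbT.
apply: measurable_and; last exact: IH.
apply: measurable_fun_ltr; first exact: measurable_arrival.
by apply: measurable_funM => //; apply: mf; rewrite mem_head.
Qed.

Lemma measurable_spacing_sum i d s :
  (forall x, x \in s -> measurable_fun [set: Z] (f x)) ->
  measurable_fun [set: Z] (fun z => spacing_sum i (f ^~ z) d s).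
Proof.
elim: s d => [|x s IH] d mf /=; first exact: measurable_cst.
have mf' y : y \in s -> measurable_fun [set: Z] (f y).
  by move=> ys; apply: mf; rewrite inE ys orbT.
apply: measurable_funD; last exact: IH.
do 2 apply: measurable_funM => //.
apply: measurable_funB; last exact: measurable_arrival.
by apply: measurable_funM => //; apply: mf; rewrite mem_head.
Qed.

Lemma measurable_race_tilt tau i d s :
  (forall x, x \in s -> measurable_fun [set: Z] (f x)) ->
  measurable_fun [set: Z] (fun z => race_tilt tau i (f ^~ z) d s).
Proof.
move=> mf; apply: measurable_funM.
  by apply: measurable_natr_bool; exact: measurable_race.
apply: measurableT_comp => //; apply: measurableT_comp => //.
apply: measurable_funD; apply: measurable_funM => //.
  exact: measurable_spacing_sum.
exact: measurable_arrival.
Qed.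

End measurability.

Context d (T : measurableType d) (P : probability T R) (r : K -> {RV P >-> R}).
Hypothesis iid : iid_exp1 r.

(* Integrating out the last arrival multiplies the integral by
   [lam x / ((lam x + d) (1 + tau))], the [1 + tau] only if its spacing is
   counted, and adds [lam x] to the rate [d] of the arrivals integrated out. *)
Lemma race_mgf tau i d0 s : -1 < tau -> 0 <= d0 -> uniq s ->
  (forall x, x \in s -> 0 < lam x) ->
  (\int[P]_t (race_tilt tau i (r ^~ t) d0 s)%:E
   = (race_mass d0 s / (1 + tau) ^+ minn i (size s))%:E)%E.
Proof.
move=> tau1; have tau0 : 0 < 1 + tau by lra.
elim: s d0 => [|x s IH] d0 d00.
  move=> _ _; rewrite minn0 expr0 divr1 /= /race_tilt/=.
  under eq_integral do rewrite !mulr0 addr0 oppr0 expR0 mulr1.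
  by rewrite integral_cst//= probability_setT mule1.
move=> uxs lam0.
have lam0' y : y \in s -> 0 < lam y by move=> ys; apply: lam0; rewrite inE ys orbT.
have lamx : 0 < lam x by apply: lam0; rewrite mem_head.
have us : uniq s by case/andP: uxs.
set L := lam x + d0; have L0 : 0 < L by rewrite ltr_wpDr.
(* The tilt acting on the last spacing: [tau] if this spacing is among the first [i], and 0
   otherwise. *)
pose tau' := (size s < i)%N%:R * tau.
have tau'0 : 0 < 1 + tau' by rewrite /tau'; case: ltnP => _; rewrite ?mul1r ?mul0r//; lra.
pose h rho u := (arrival rho s < u / lam x)%R%:R * ((race rho s)%:R *
  expR (- (tau * ((size s < i)%N%:R * (L * (u / lam x - arrival rho s)) +
    spacing_sum i rho L s) + d0 * (u / lam x)))).
transitivity (\int[P]_t (h (r ^~ t) (r x t))%:E)%E.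
  apply: eq_integral => t _; rewrite /race_tilt /h /= -/L.
  by case: ltP => _; rewrite ?mul1r ?mul0r.
rewrite (integral_indep iid uxs); last 2 first.
- by move=> rho u; rewrite !mulr_ge0 ?expR_ge0.
- move=> d' Z f g mf mg; apply: measurable_funM.
    apply: measurable_natr_bool; apply: measurable_fun_ltr.
      exact: measurable_arrival.
    exact: measurable_funM.
  apply: measurable_funM.
    by apply: measurable_natr_bool; exact: measurable_race.
  apply: measurableT_comp => //; apply: measurableT_comp => //.
  apply: measurable_funD; last by do 2 apply: measurable_funM => //.
  apply: measurable_funM => //.
  apply: measurable_funD; last exact: measurable_spacing_sum.
  do 2 apply: measurable_funM => //.
  by apply: measurable_funB; [exact: measurable_funM|exact: measurable_arrival].
have inner rho : (\int[distribution P (r x)]_u (h rho u)%:E =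
    (lam x / (L * (1 + tau')))%:E * (race_tilt tau i rho L s)%:E)%E.
  rewrite /race_tilt; have [rs|rs] := boolP (race rho s); last first.
    rewrite mul0r mule0; apply: integral0_eq => u _.
    by rewrite /h (negbTE rs) mul0r mulr0.
  pose b := arrival rho s; have b0 : 0 <= b by exact: race_arrival_ge0.
  (* [- kappa] is the coefficient of [u] in the exponent; with the 1 of the exponential density the
     total is [L * (1 + tau') / lam x]. Evaluated at [u = b * lam x], the terms [tau' * L * b]
     cancel against [c] and leave exp(- L b), which is the tilt of rate [L] for the remaining
     keys. *)
  pose kappa := (tau' * L + d0) / lam x.
  have kE : 1 + kappa = L * (1 + tau') / lam x.
    by rewrite /kappa /L; field; rewrite gt_eqF.
  have k0 : 0 < 1 + kappa by rewrite kE divr_gt0// mulr_gt0.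
  pose c := expR (- (tau * spacing_sum i rho L s) + tau' * L * b).
  transitivity (c%:E * \int[distribution P (r x)]_u
      ((b * lam x < u)%R%:R * expR (- kappa * u))%:E)%E.
    rewrite -ge0_integralZl//=; last 2 first.
    + apply/measurable_EFinP; apply: measurable_funM.
        by apply: measurable_natr_bool; exact: measurable_fun_ltr.
      by apply: measurableT_comp => //; exact: mulrl_measurable.
    + by rewrite lee_fin expR_ge0.
    apply: eq_integral => u _; rewrite -EFinM; congr _%:E.
    rewrite /h rs mul1r -/b -ltr_pdivlMr// [RHS]mulrCA; congr (_ * _).
    rewrite /c -expRD; congr expR; rewrite /kappa /tau' -/b; ring.
  rewrite (@integral_exponential_tail _ (b * lam x) kappa)//; last 2 first.
    by case: iid => + _; apply.
    by rewrite mulr_ge0// ltW.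
  rewrite -!EFinM; congr _%:E; rewrite mul1r /c.
  have -> : expR (- (tau * spacing_sum i rho L s) + tau' * L * b) *
    (expR (- (1 + kappa) * (b * lam x)) / (1 + kappa)) =
    expR (- (tau * spacing_sum i rho L s) + tau' * L * b - (1 + kappa) * (b * lam x))
    / (1 + kappa) by rewrite mulrA -expRD mulNr.
  rewrite kE -/b mulrC; congr (_ * expR _).
    by rewrite invf_div.
  by field; rewrite gt_eqF.
under eq_integral do rewrite inner.
rewrite ge0_integralZl//=; last 3 first.
- by apply/measurable_EFinP; apply: measurable_race_tilt.
- by move=> t _; rewrite lee_fin mulr_ge0// expR_ge0.
- by rewrite lee_fin divr_ge0 ?mulr_ge0 ?ltW.
rewrite IH ?ltW//= -EFinM -/L; congr _%:E.
have -> : (1 + tau) ^+ minn i (size s).+1 = (1 + tau') * (1 + tau) ^+ minn i (size s).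
  rewrite /tau'; case: ltnP => si.
    by rewrite (minn_idPr si) exprS mul1r.
  by rewrite (minn_idPl (leqW si)) mul0r addr0 mul1r.
by rewrite !invfM; ring.
Qed.

End race.

(** * Chernoff bounds within one order *)

Section race_concentration.
Context {R : realType} {K : eqType} (lam : K -> R).
Context d (T : measurableType d) (P : probability T R) (r : K -> {RV P >-> R}).
Hypothesis iid : iid_exp1 r.
Implicit Types s : seq K.

Lemma expR1_le4 : expR 1 <= 4 :> R.
Proof.
have h : (1 / 2 : R) <= expR (- (1 / 2)) by rewrite (le_trans _ (expR_ge1Dx _))//; lra.
have : (1 / 4 : R) <= expR (-1).
  have -> : (-1 : R) = - (1 / 2) + - (1 / 2) by lra.
  rewrite expRD; nra.
rewrite expRN => h1; rewrite -[leLHS]invrK -[leRHS]invrK lef_pV2 ?posrE ?invr_gt0 ?expR_gt0//.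
by rewrite (le_trans _ h1)// div1r.
Qed.

Lemma expRN_nat k : expR (- k%:R) = expR (-1) ^+ k :> R.
Proof. by rewrite -expRM_natl mulrN1. Qed.

Lemma measurable_race_setU s (b : T -> bool) : measurable_fun [set: T] b ->
  measurable [set t | race lam (r ^~ t) s && b t].
Proof.
move=> mb; rewrite -[X in measurable X]setTI.
have : measurable_fun [set: T] (fun t => race lam (r ^~ t) s && b t).
  by apply: measurable_and => //; exact: measurable_race.
by move=> /(_ measurableT [set true]); rewrite setTI; apply.
Qed.

Lemma race_prob s : uniq s -> (forall x, x \in s -> 0 < lam x) ->
  P [set t | race lam (r ^~ t) s] = (race_mass lam 0 s)%:E.
Proof.
move=> us lam0.
have := @race_mgf _ _ lam _ _ _ _ iid 0 0%N 0 s (ltrN10 _) (lexx 0) us lam0.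
rewrite min0n expr0 divr1 => <-.
rewrite -[X in P X]setIT -integral_indic//=; last first.
  have := @measurable_race_setU s (fun=> true) (measurable_cst _).
  by under eq_set do rewrite andbT.
apply: eq_integral => t _; rewrite /race_tilt !mul0r addr0 oppr0 expR0 mulr1.
by rewrite indicE mem_setE.
Qed.

(* [tau < 0] bounds the upper tail, [tau > 0] the lower one. *)
Lemma race_chernoff tau i a s : -1 < tau -> uniq s ->
  (forall x, x \in s -> 0 < lam x) -> (i <= size s)%N ->
  (P [set t | race lam (r ^~ t) s &&
       (tau * spacing_sum lam i (r ^~ t) 0 s <= tau * a)%R] <=
   ((expR (tau * a) / (1 + tau) ^+ i))%:E * P [set t | race lam (r ^~ t) s])%E.
Proof.
move=> tau1 us lam0 is_.
have mE : measurable [set t | race lam (r ^~ t) s &&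
       (tau * spacing_sum lam i (r ^~ t) 0 s <= tau * a)].
  apply: measurable_race_setU; apply: measurable_fun_ler => //.
  by apply: measurable_funM => //; exact: measurable_spacing_sum.
rewrite race_prob// -[X in P X]setIT -integral_indic//.
(* Markov's inequality: on the event, the tilt is at least exp(- tau a). *)
apply: (@le_trans _ _ (\int[P]_t
  ((expR (tau * a))%:E * (race_tilt lam tau i (r ^~ t) 0 s)%:E))%E).
  apply: ge0_le_integral => //=.
  - exact/measurable_EFinP/measurable_indic.
  - apply/measurable_EFinP; apply: measurable_funM => //.
    by apply: measurable_race_tilt.
  - move=> t _; rewrite -EFinM lee_fin indicE mem_setE unfold_in /race_tilt mul0r addr0.
    case: (race _ _ _) => /=; last by rewrite !mul0r mulr0.
    case: (leP (tau * _)) => /= h; last by rewrite !mulr_ge0 ?expR_ge0.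
    by rewrite mul1r -expRD -[leLHS]expR0 ler_expR subr_ge0.
rewrite ge0_integralZl//=; last 2 first.
- by apply/measurable_EFinP; apply: measurable_race_tilt.
- by move=> t _; rewrite lee_fin mulr_ge0// expR_ge0.
rewrite (@race_mgf _ _ lam _ _ _ _ iid)//= -!EFinM lee_fin (minn_idPl is_).
by rewrite mulrA mulrAC.
Qed.

(** The upper bound is needed at [k] only, the lower bounds at every later index, from [k + 1] to
    [size s]. The constants 4 and 16 make each of the two failures cost at most e^(-k), the second
    one after a union bound over the indices. *)
Definition race_good k (rho : K -> R) s : bool :=
  (spacing_sum lam k rho 0 s <= 4 * k%:R) &&
  all (fun i => i%:R / 16 <= spacing_sum lam i rho 0 s) (iota k.+1 (size s - k)).

Lemma measurable_race_good k d' (Z : measurableType d') (f : K -> Z -> R) s :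
  (forall x, x \in s -> measurable_fun [set: Z] (f x)) ->
  measurable_fun [set: Z] (fun z => race_good k (f ^~ z) s).
Proof.
move=> mf; apply: measurable_and.
  by apply: measurable_fun_ler => //; exact: measurable_spacing_sum.
elim: (iota _ _) => //= i l IH; apply: measurable_and => //.
by apply: measurable_fun_ler => //; exact: measurable_spacing_sum.
Qed.

(** The induction closes because two copies of [x ^+ k.+1] fit in [x ^+ k]. *)
Let tail_sum (x : R) k m : 0 <= x -> x <= 1 / 2 ->
  \sum_(i <- iota k.+1 m) x ^+ i <= x ^+ k.
Proof.
move=> x0 x2; elim: m k => [|m IH] k; first by rewrite big_nil exprn_ge0.
rewrite /= big_cons (le_trans (lerD (lexx _) (IH _)))// exprS.
have := exprn_ge0 k x0; nra.
Qed.

(** The tilt -1/2 bounds the upper tail by e^(-2k) 2^k, which is at most e^(-k) as 2 <= e. The tilt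
    16 bounds the lower tail at i by (e/17)^i; the sum over i > k is at most (e/17)^k, and e/17 <=
    1/e because e <= 4. *)
Lemma race_good_concentration k s : uniq s ->
  (forall x, x \in s -> 0 < lam x) -> (k <= size s)%N ->
  (P [set t | race lam (r ^~ t) s && ~~ race_good k (r ^~ t) s] <=
   (2 * expR (- k%:R))%:E * P [set t | race lam (r ^~ t) s])%E.
Proof.
move=> us lam0 ks.
pose E1 := [set t | race lam (r ^~ t) s &&
       (- (1/2) * spacing_sum lam k (r ^~ t) 0 s <= - (1/2) * (4 * k%:R))].
pose E2 i := [set t | race lam (r ^~ t) s &&
       (16 * spacing_sum lam i (r ^~ t) 0 s <= 16 * (i%:R / 16))].
pose E3 := [set t | race lam (r ^~ t) s && ~~ all
  (fun i => i%:R / 16 <= spacing_sum lam i (r ^~ t) 0 s) (iota k.+1 (size s - k))].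
have mS i : measurable_fun [set: T] (fun t => spacing_sum lam i (r ^~ t) 0 s).
  exact: measurable_spacing_sum.
have mE1 : measurable E1.
  apply: measurable_race_setU; apply: measurable_fun_ler => //.
  exact: measurable_funM.
have mE2 i : measurable (E2 i).
  apply: measurable_race_setU; apply: measurable_fun_ler => //.
  exact: measurable_funM.
have mall l : measurable_fun [set: T] (fun t => all
  (fun i => i%:R / 16 <= spacing_sum lam i (r ^~ t) 0 s) l).
  elim: l => //= i l IH; apply: measurable_and => //.
  exact: measurable_fun_ler.
have mE3 : measurable E3.
  by apply: measurable_race_setU; exact: measurable_neg.
have prP := race_prob us lam0.
set p := P [set t | race lam (r ^~ t) s]; rewrite -/p in prP.
have p0 : (0 <= p)%E by exact: measure_ge0.
have h1 : (P E1 <= (expR (- k%:R))%:E * p)%E.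
  apply: (le_trans (@race_chernoff _ _ _ _ _ us lam0 ks)); first by lra.
  rewrite lee_wpmul2r// lee_fin expRN_nat.
  have -> : - (1 / 2) * (4 * k%:R) = - k%:R + - k%:R :> R by lra.
  rewrite expRD expRN_nat -mulrA ler_piMr ?exprn_ge0 ?expR_ge0//.
  have -> : 1 + - (1 / 2) = 2^-1 :> R by lra.
  rewrite -exprVn invrK -exprMn exprn_ile1 ?mulr_ge0 ?expR_ge0//.
  rewrite expRN mulrC ler_pdivrMr ?expR_gt0// mul1r.
  by rewrite (le_trans _ (expR_ge1Dx _))//; lra.
have h2 i : i \in iota k.+1 (size s - k) ->
  (P (E2 i) <= ((expR 1 / 17) ^+ i)%:E * p)%E.
  rewrite mem_iota => /andP[ki im].
  have is_ : (i <= size s)%N by lia.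
  apply: (le_trans (@race_chernoff _ _ _ _ _ us lam0 is_)); first by lra.
  rewrite lee_wpmul2r// lee_fin.
  have -> : 16 * (i%:R / 16) = i%:R * 1 :> R by lra.
  by rewrite expRM_natl expr_div_n (_ : 1 + 16 = 17 :> R)//; lra.
pose E4 l := [set t | race lam (r ^~ t) s && ~~ all
  (fun i => i%:R / 16 <= spacing_sum lam i (r ^~ t) 0 s) l].
have mE4 l : measurable (E4 l).
  by apply: measurable_race_setU; exact: measurable_neg.
have h4 l : (P (E4 l) <= \sum_(i <- l) P (E2 i))%E.
  elim: l => [|i l IH].
    rewrite big_nil (_ : E4 _ = set0) ?measure0// -subset0 => t /=.
    by rewrite /E4/= andbF.
  rewrite big_cons; apply: le_trans (leeD (lexx _) IH).
  apply: le_trans (measureU2 _ (mE2 i) (mE4 l)).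
  apply: le_measure; rewrite ?inE//; first exact: measurableU.
  move=> t /= /andP[rt]; rewrite negb_and -ltNge => /orP[h|h]; [left|right].
    by rewrite /E2/= rt/= ler_pM2l// ltW.
  by rewrite /E4/= rt h.
have h3 : (P E3 <= (expR (- k%:R))%:E * p)%E.
  apply: (le_trans (h4 _)).
  apply: (@le_trans _ _ (\sum_(i <- iota k.+1 (size s - k)) (((expR 1 / 17) ^+ i)%:E * p))%E).
    by rewrite big_seq [leRHS]big_seq; apply: lee_sum => i; exact: h2.
  rewrite -ge0_sume_distrl; last first.
    by move=> i _; rewrite lee_fin exprn_ge0 ?divr_ge0 ?expR_ge0.
  rewrite lee_wpmul2r// sumEFin lee_fin.
  have e4 := expR1_le4; have e0 := expR_gt0 (1 : R).
  apply: (le_trans (tail_sum _ _ _ _)); rewrite ?divr_ge0//; first by lra.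
  rewrite expRN_nat lerXn2r ?nnegrE ?divr_ge0 ?expR_ge0//.
  by rewrite expRN ler_pdivrMr// ler_pdivlMl//; nra.
apply: (@le_trans _ _ (P (E1 `|` E3))).
  apply: le_measure; rewrite ?inE//; [|exact: measurableU|].
    by apply: measurable_race_setU; apply: measurable_neg; exact: measurable_race_good.
  move=> t /= /andP[rt]; rewrite negb_and -ltNge => /orP[h|h]; [left|right] => /=.
    by rewrite /E1/= rt/= ler_nM2l ?ltW//; lra.
  by rewrite /E3/= rt h.
apply: (le_trans (measureU2 _ mE1 mE3)).
apply: (le_trans (leeD h1 h3)).
by rewrite prP -!EFinM -EFinD lee_fin; lra.
Qed.

End race_concentration.

(** * Arrival times compared with spacing sums *)

Section race_domination.
Context {R : realType} {K : eqType} (lam : K -> R).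
Implicit Types (rho : K -> R) (s l : seq K).

Lemma race_cons rho x s : race lam rho (x :: s) =
  (arrival lam rho s < rho x / lam x) && race lam rho s.
Proof. by []. Qed.

Lemma spacing_sum_cons i rho d x s : spacing_sum lam i rho d (x :: s) =
  (size s < i)%N%:R * ((lam x + d) * (rho x / lam x - arrival lam rho s)) +
  spacing_sum lam i rho (lam x + d) s.
Proof. by []. Qed.

Lemma race_cat rho s1 s2 : race lam rho (s1 ++ s2) -> race lam rho s2.
Proof. by elim: s1 => //= x s1 IH /andP[_ /IH]. Qed.

Lemma spacing_sum_cat i rho d s1 s2 : (i <= size s2)%N ->
  spacing_sum lam i rho d (s1 ++ s2) =
  spacing_sum lam i rho (d + \sum_(x <- s1) lam x) s2.
Proof.
move=> i2; elim: s1 d => [|x s1 IH] d; first by rewrite big_nil addr0.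
rewrite /= ltnNge (leq_trans i2) ?size_cat ?leq_addl// mul0r add0r IH big_cons.
by rewrite addrCA addrA.
Qed.

(** Until [y] arrives, [y] and the keys after it are still to come, so every spacing has weight at
    least [lam y + d]; the spacings themselves telescope to the arrival time of [y]. *)
Lemma arrival_le_spacing_sum i rho d y s : race lam rho (y :: s) -> 0 <= d ->
  (forall x, x \in y :: s -> 0 < lam x) -> (size (y :: s) <= i)%N ->
  (lam y + d) * arrival lam rho (y :: s) <= spacing_sum lam i rho d (y :: s).
Proof.
elim: s y d => [|z s IH] y d.
  by move=> _ _ _ /= ->; rewrite subr0 addr0 mul1r.
rewrite race_cons => /andP[lt rz] d0 lam0 si.
have ly : 0 < lam y by apply: lam0; rewrite mem_head.
have lz : 0 < lam z by apply: lam0; rewrite !inE eqxx orbT.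
have lam0' x : x \in z :: s -> 0 < lam x by move=> xs; apply: lam0; rewrite inE xs orbT.
have := IH z (lam y + d) rz (addr_ge0 (ltW ly) d0) lam0' (ltnW si).
have := race_arrival_ge0 rz.
have si' : (size (z :: s) < i)%N := si.
rewrite (spacing_sum_cons i rho d y) si' mul1r.
rewrite [arrival _ _ (y :: _)]/= [arrival _ _ (z :: s)]/= => az h.
apply: (@le_trans _ _ ((lam y + d) * (rho y / lam y - rho z / lam z) +
  (lam z + (lam y + d)) * (rho z / lam z))); last by rewrite lerD2l.
nra.
Qed.

(* The total rate of the keys still to arrive only decreases with time. *)
Lemma spacing_sum_le i rho d s1 y s2 : race lam rho (s1 ++ y :: s2) ->
  (forall x, x \in s1 ++ y :: s2 -> 0 < lam x) ->
  (size (s1 ++ y :: s2) <= i)%N ->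
  let D := d + \sum_(x <- s1) lam x in
  spacing_sum lam i rho d (s1 ++ y :: s2) <=
  spacing_sum lam i rho D (y :: s2) +
  (lam y + D) * (arrival lam rho (s1 ++ y :: s2) - arrival lam rho (y :: s2)).
Proof.
elim: s1 d => [|x s1 IH] d rs lam0 si.
  by cbv zeta; rewrite big_nil addr0 subrr mulr0 addr0.
cbv zeta; rewrite big_cons.
have lx : 0 < lam x by apply: lam0; rewrite mem_head.
have ly : 0 < lam y by apply: lam0; rewrite inE mem_cat mem_head !orbT.
move: rs; rewrite cat_cons race_cons => /andP[lt rs].
have lam0' z : z \in s1 ++ y :: s2 -> 0 < lam z.
  by move=> zs; apply: lam0; rewrite inE zs orbT.
have := IH (lam x + d) rs lam0' (ltnW si); cbv zeta.
have -> : lam x + d + \sum_(z <- s1) lam z = d + (lam x + \sum_(z <- s1) lam z) by ring.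
have S0 : 0 <= \sum_(z <- s1) lam z.
  rewrite big_seq sumr_ge0// => z zs; apply/ltW/lam0'.
  by rewrite mem_cat zs.
have si' : (size (s1 ++ y :: s2) < i)%N := si.
rewrite (spacing_sum_cons i rho d x) si' mul1r => h; apply: le_trans (lerD (lexx _) h) _.
rewrite [arrival _ _ (x :: _)]/=; nra.
Qed.

Lemma spacing_sum_full i i' rho d s : (size s <= i)%N -> (size s <= i')%N ->
  spacing_sum lam i rho d s = spacing_sum lam i' rho d s.
Proof.
elim: s d => //= x s IH d si si'.
by rewrite si si' (IH _ (ltnW si) (ltnW si')).
Qed.

Lemma race_arrival_le rho s1 s2 : race lam rho (s1 ++ s2) ->
  arrival lam rho s2 <= arrival lam rho (s1 ++ s2).
Proof.
elim: s1 => // x s1 IH; rewrite cat_cons race_cons => /andP[lt /IH le].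
exact: le_trans le (ltW lt).
Qed.

Lemma arrival_rev rho l :
  arrival lam rho (rev l) = last 0 [seq rho x / lam x | x <- l].
Proof.
by elim/last_ind: l => // l x _; rewrite rev_rcons map_rcons last_rcons.
Qed.

Lemma race_rev rho l :
  race lam rho (rev l) = path <%R 0 [seq rho x / lam x | x <- l].
Proof.
elim/last_ind: l => // l x IH.
by rewrite rev_rcons race_cons map_rcons rcons_path -IH arrival_rev andbC.
Qed.

Lemma rev_take x0 k l : (0 < k <= size l)%N ->
  rev (take k l) = nth x0 l k.-1 :: rev (take k.-1 l).
Proof. by case: k => //= k kl; rewrite (take_nth x0)// rev_rcons. Qed.

(* With [S_i] the sum of the first [i] normalized spacings and [a_i] the i-th
   arrival, [a_k / a_i <= S_k / S_i]. *)
Lemma race_good_ratio x0 k j rho l : race lam rho (rev l) ->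
  race_good lam k rho (rev l) -> (forall x, x \in l -> 0 < lam x) ->
  (0 < k <= j)%N -> (j < size l)%N ->
  rho (nth x0 l k.-1) / lam (nth x0 l k.-1) * j.+1%:R <=
  64 * k%:R * (rho (nth x0 l j) / lam (nth x0 l j)).
Proof.
move=> rl /andP[Sk /allP SS] lam0 /andP[k0 kj] jl.
have kl : (k <= size l)%N by exact: leq_trans kj (ltnW jl).
have {SS}Sj : j.+1%:R / 16 <= spacing_sum lam j.+1 rho 0 (rev l).
  by apply: SS; rewrite mem_iota size_rev; lia.
set y := nth x0 l k.-1.
(* The first [j + 1] arrivals are cut at [y], the k-th one. [D1] is the rate left after all of them,
   and [lam y + D2] the rate in force just before [y] arrives. *)
pose s2 := rev (take k.-1 l); pose s1 := rev (drop k (take j.+1 l)).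
have e1 : rev (take k l) = y :: s2 by rewrite (rev_take x0)// k0.
have e2 : rev (take j.+1 l) = s1 ++ y :: s2.
  rewrite -e1 /s1 -rev_cat; congr rev.
  by rewrite -[LHS](cat_take_drop k) take_takel// leqW.
have e3 : rev l = rev (drop j.+1 l) ++ rev (take j.+1 l).
  by rewrite -rev_cat cat_take_drop.
have sk : size (y :: s2) = k by rewrite -e1 size_rev size_takel.
have sj : size (s1 ++ y :: s2) = j.+1 by rewrite -e2 size_rev size_takel.
have aj : arrival lam rho (s1 ++ y :: s2) = rho (nth x0 l j) / lam (nth x0 l j).
  by rewrite -e2 (rev_take x0).
have r2 : race lam rho (s1 ++ y :: s2).
  by move: rl; rewrite e3 e2 => /race_cat.
have lam0' x : x \in s1 ++ y :: s2 -> 0 < lam x.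
  by rewrite -e2 mem_rev => /mem_take; exact: lam0.
pose D1 := \sum_(x <- rev (drop j.+1 l)) lam x.
pose D2 := D1 + \sum_(x <- s1) lam x.
have D10 : 0 <= D1.
  rewrite /D1 big_seq sumr_ge0// => x; rewrite mem_rev => /mem_drop xl.
  exact/ltW/lam0.
have D20 : 0 <= D2.
  rewrite addr_ge0// big_seq sumr_ge0// => x xs; apply/ltW/lam0'.
  by rewrite mem_cat xs.
have E1 : spacing_sum lam j.+1 rho 0 (rev l) =
    spacing_sum lam j.+1 rho D1 (s1 ++ y :: s2).
  by rewrite e3 e2 spacing_sum_cat ?sj// add0r.
have E2 : spacing_sum lam k rho 0 (rev l) = spacing_sum lam k rho D2 (y :: s2).
  rewrite e3 e2 spacing_sum_cat ?sj ?leqW// add0r -/D1.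
  by rewrite spacing_sum_cat ?sk.
rewrite {}E1 in Sj; rewrite {}E2 in Sk.
have := spacing_sum_le D1 r2 lam0' (eq_leq sj); cbv zeta; rewrite -/D2 => h1.
have r3 : race lam rho (y :: s2) by exact: race_cat r2.
have := arrival_le_spacing_sum r3 D20 _ (eq_leq sk).
rewrite (@spacing_sum_full j.+1 k rho D2 (y :: s2)) ?sk ?leqW// in h1.
have ay0 := race_arrival_ge0 r3.
have ayj := race_arrival_le r2.
rewrite aj in h1 ayj.
rewrite [arrival _ _ (y :: _)]/= in h1 ay0 ayj *.
set a := rho y / lam y in h1 ay0 ayj *; set b := rho (nth x0 l j) / _ in h1 ayj *.
set S := spacing_sum _ _ _ D2 _ in Sk h1 *; set S' := spacing_sum _ _ _ D1 _ in Sj h1 *.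
move=> h2; have {}h2 : (lam y + D2) * a <= S.
  by apply: h2 => x xs; apply: lam0'; rewrite mem_cat xs orbT.
(* Write m for [lam y + D2]. From S' <= S + m (b - a) and m a <= S follows a S' <= a S + S (b - a) =
   S b. The bounds 4 k on S and (j + 1) / 16 on S' then give the factor 64 = 4 * 16. *)
have h3 : a * S' <= S * b.
  have hba : 0 <= b - a by rewrite subr_ge0.
  have g1 := ler_wpM2l ay0 h1; have g2 := ler_wpM2r hba h2.
  lra.
have b0 : 0 <= b by exact: le_trans ayj.
have h4 : a * (j.+1%:R / 16) <= a * S' by exact: ler_wpM2l.
have h5 : S * b <= 4 * k%:R * b by exact: ler_wpM2r.
lra.
Qed.

End race_domination.

(** * Harmonic and power sums *)

Section power_sums.
Context {R : realType}.

Lemma ln_natS_ge (j : nat) : (0 < j)%N ->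
  j.+1%:R^-1 <= ln j.+1%:R - ln j%:R :> R.
Proof.
move=> j0; have j0' : 0 < j%:R :> R by rewrite ltr0n.
have j1 : 0 < j.+1%:R :> R by rewrite ltr0n.
rewrite -ln_div ?posrE// -[leRHS]opprK -lnV ?posrE ?divr_gt0// invf_div lerNr.
have -> : j%:R / j.+1%:R = 1 + - j.+1%:R^-1 :> R.
  by rewrite -natr1; field; rewrite natr1 pnatr_eq0.
by apply: le_ln1Dx; rewrite ltrN2 invf_lt1// ltr1n.
Qed.

Lemma sum_harmonic_le (k m : nat) : (0 < k <= m)%N ->
  \sum_(k <= j < m) k%:R / j.+1%:R <= k%:R * ln m%:R :> R.
Proof.
move=> /andP[k0 km].
apply: (@le_trans _ _ (\sum_(k <= j < m) k%:R * (ln j.+1%:R - ln j%:R))).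
  rewrite big_nat [leRHS]big_nat ler_sum// => j /andP[kj _].
  by rewrite ler_wpM2l// ln_natS_ge// (leq_trans k0).
rewrite -mulr_sumr telescope_sumr// ler_wpM2l// gerBl ln_ge0//.
by rewrite ler1n.
Qed.

(** A discrete integral comparison: with f j = - j^(1 - rho), the increment of f from j to j + 1 is
    at least (rho - 1) (j + 1)^(- rho), and the increments telescope. *)
Lemma sum_powR_le (rho : R) (k m : nat) : 1 < rho -> (0 < k <= m)%N ->
  \sum_(k <= j < m) (k%:R / j.+1%:R) `^ rho <= k%:R / (rho - 1) :> R.
Proof.
move=> rho1 /andP[k0 km]; have r0 : 0 < rho - 1 by rewrite subr_gt0.
have kR : 0 < k%:R :> R by rewrite ltr0n.
pose f (j : nat) : R := - expR ((1 - rho) * ln j%:R).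
rewrite ler_pdivlMr// mulrC mulr_sumr.
apply: (@le_trans _ _ (\sum_(k <= j < m) expR (rho * ln k%:R) * (f j.+1 - f j))).
  rewrite big_nat [leRHS]big_nat ler_sum// => j /andP[kj _].
  have j0 : (0 < j)%N by exact: leq_trans kj.
  have jR : 0 < j%:R :> R by rewrite ltr0n.
  have jS : 0 < j.+1%:R :> R by rewrite ltr0n.
  rewrite /powR gt_eqF ?divr_gt0// ln_div ?posrE// mulrBr expRD mulrCA ler_wpM2l ?expR_ge0//.
  rewrite /f opprK addrC.
  have -> : (1 - rho) * ln j%:R = (1 - rho) * ln j.+1%:R +
    (rho - 1) * (ln j.+1%:R - ln j%:R) :> R by ring.
  have -> : (1 - rho) * ln j.+1%:R = ln j.+1%:R + - (rho * ln j.+1%:R) :> R by ring.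
  rewrite !expRD lnK ?posrE//.
  have h := expR_ge1Dx ((rho - 1) * (ln j.+1%:R - ln j%:R)).
  have g := ln_natS_ge j0.
  have e0 := expR_ge0 (- (rho * ln j.+1%:R)).
  have h2 : 1 + (rho - 1) * j.+1%:R^-1 <= expR ((rho - 1) * (ln j.+1%:R - ln j%:R)).
    by apply: le_trans h; rewrite lerD2l ler_wpM2l// ltW.
  have h3 : j.+1%:R + (rho - 1) <= j.+1%:R * expR ((rho - 1) * (ln j.+1%:R - ln j%:R)).
    apply: le_trans (ler_wpM2l (ltW jS) h2).
    by rewrite mulrDr mulr1 mulrCA divff ?mulr1// gt_eqF.
  have := ler_wpM2r e0 h3; lra.
rewrite -mulr_sumr telescope_sumr// /f opprK.
apply: (@le_trans _ _ (expR (rho * ln k%:R) * expR ((1 - rho) * ln k%:R))).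
  by rewrite ler_wpM2l ?expR_ge0// gerDr oppr_le0 expR_ge0.
by rewrite -expRD -mulrDl addrC subrK mul1r lnK.
Qed.

End power_sums.

(** * Residual heavy hitters of the transformed vector *)

Section ordered_transform.
Context {R : realType} {K : eqType} (p : R) (w : K -> R).
Hypothesis p_gt0 : 0 < p.
Implicit Types (rho : K -> R) (l : seq K).

Definition exp_rate (x : K) : R := `|w x| `^ p.

Lemma exp_rate_gt0 x : w x != 0 -> 0 < exp_rate x.
Proof. by move=> wx; rewrite powR_gt0// normr_gt0. Qed.

Lemma norm_transform rho x : w x != 0 -> 0 < rho x ->
  `|transform p w rho x| = (rho x / exp_rate x) `^ (- p^-1).
Proof.
move=> wx rx; have wx0 : 0 < `|w x| by rewrite normr_gt0.
rewrite /transform normrM normfV (ger0_norm (powR_ge0 _ _)).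
have a0 : 0 < rho x / exp_rate x by rewrite divr_gt0// exp_rate_gt0.
rewrite {2}/powR gt_eqF// ln_div ?posrE ?exp_rate_gt0// ln_powR.
have -> : - p^-1 * (ln (rho x) - p * ln `|w x|) =
  ln `|w x| - p^-1 * ln (rho x) by field; rewrite gt_eqF.
by rewrite expRD lnK ?posrE// expRN /powR (gt_eqF rx).
Qed.

Section race.
Variables (rho : K -> R) (l : seq K).
Hypotheses (w_neq0 : forall x, x \in l -> w x != 0)
  (racel : race exp_rate rho (rev l)).
Let v := transform p w rho.
Let a x := rho x / exp_rate x.

Lemma race_gt0 x : x \in l -> 0 < a x.
Proof.
move=> xl; have := racel; rewrite race_rev.
move=> /(order_path_min lt_trans)/allP; apply.
by apply/mapP; exists x.
Qed.

Lemma race_rv_gt0 x : x \in l -> 0 < rho x.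
Proof.
move=> xl; have := race_gt0 xl; rewrite /a pmulr_lgt0//.
by rewrite invr_gt0 exp_rate_gt0// w_neq0.
Qed.

Lemma race_norm x : x \in l -> `|v x| = a x `^ (- p^-1).
Proof. by move=> xl; rewrite /v norm_transform ?w_neq0 ?race_rv_gt0. Qed.

Lemma race_norm_gt0 x : x \in l -> 0 < `|v x|.
Proof. by move=> xl; rewrite race_norm// powR_gt0// race_gt0. Qed.

Lemma race_sorted x0 i j : (i < j)%N -> (j < size l)%N ->
  `|v (nth x0 l j)| < `|v (nth x0 l i)|.
Proof.
move=> ij jl; have il := ltn_trans ij jl.
rewrite !race_norm ?mem_nth//.
have h : a (nth x0 l i) < a (nth x0 l j).
  have := racel; rewrite race_rev => /path_sorted.
  move=> /(sorted_ltn_nth lt_trans 0)/(_ i j).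
  by rewrite !inE !size_map !(nth_map x0)//; apply.
rewrite !powRN ltf_pV2 ?posrE ?powR_gt0 ?race_gt0 ?mem_nth//.
by rewrite gt0_ltr_powR ?invr_gt0// nnegrE ltW// race_gt0// mem_nth.
Qed.

Section good.
Variables (k : nat) (x0 : K).
Hypotheses (k_gt0 : (0 < k)%N) (goodl : race_good exp_rate k rho (rev l)).
Let vk := `|v (nth x0 l k.-1)|.

Lemma race_good_norm j : (k <= j < size l)%N ->
  `|v (nth x0 l j)| <= vk * (64 * (k%:R / j.+1%:R)) `^ p^-1.
Proof.
move=> /andP[kj jl].
have kl : (k.-1 < size l)%N by lia.
rewrite /vk !race_norm ?mem_nth//.
set b := a (nth x0 l k.-1); set c := a (nth x0 l j).
have b0 : 0 < b by apply: race_gt0; rewrite mem_nth.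
have c0 : 0 < c by apply: race_gt0; rewrite mem_nth.
have := @race_good_ratio _ _ exp_rate x0 k j rho l racel goodl _ _ jl.
rewrite -/b -/c k_gt0 kj => /(_ _ isT) h.
have {}h : b * j.+1%:R <= 64 * k%:R * c.
  by apply: h => x xl; rewrite exp_rate_gt0// w_neq0.
have {}h : b <= c * (64 * (k%:R / j.+1%:R)).
  by rewrite !mulrA ler_pdivlMr ?ltr0n//; lra.
rewrite !powRN [leRHS]mulrC ler_pdivlMr ?powR_gt0// ler_pdivrMl ?powR_gt0//.
have u0 : 0 <= 64 * (k%:R / j.+1%:R) :> R by rewrite mulr_ge0// divr_ge0.
rewrite -(powRM _ (ltW c0) u0).
apply: ge0_ler_powR => //; rewrite ?invr_ge0 ?(ltW p_gt0)// nnegrE.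
  exact: ltW.
exact: le_trans (ltW b0) h.
Qed.

Lemma race_good_tail (q : nat) :
  \sum_(x <- drop k l) `|v x| ^+ q <=
  vk ^+ q * (64 `^ (q%:R / p) *
    \sum_(k <= j < size l) (k%:R / j.+1%:R) `^ (q%:R / p)).
Proof.
have -> : \sum_(x <- drop k l) `|v x| ^+ q =
    \sum_(k <= j < size l) `|v (nth x0 l j)| ^+ q.
  rewrite (big_nth x0) size_drop -[in RHS](add0n k) big_addn.
  by apply: eq_bigr => i _; rewrite nth_drop addnC.
rewrite mulrA mulr_sumr big_nat [leRHS]big_nat ler_sum// => j kj.
have h := race_good_norm kj.
have {h} : `|v (nth x0 l j)| ^+ q <= (vk * (64 * (k%:R / j.+1%:R)) `^ p^-1) ^+ q.
  by apply: lerXn2r; rewrite ?nnegrE ?mulr_ge0 ?powR_ge0 ?normr_ge0.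
move=> h; apply: (le_trans h).
rewrite exprMn -mulrA; apply: ler_wpM2l; first by rewrite exprn_ge0 ?normr_ge0.
have u0 : 0 <= k%:R / j.+1%:R :> R by rewrite divr_ge0.
rewrite -powRM// -powR_mulrn ?powR_ge0// -powRrM [p^-1 * _]mulrC.
exact: lexx.
Qed.

(** A factor 3 in magnitude is a factor 3^p in arrival time, which is at most 9 as p <= 2. Combined
    with the factor 64 of the ratio bound this gives 576 = 9 * 64. *)
Lemma race_good_count x : p <= 2 -> (k <= size l)%N -> x \in l ->
  vk <= 3 * `|v x| -> (index x l < 576 * k)%N.
Proof.
move=> p2 kl xl h.
have [jk|kj] := ltnP (index x l) k; first by lia.
have jl : (index x l < size l)%N by rewrite index_mem.
have := @race_good_norm (index x l); rewrite kj jl nth_index// => /(_ isT) g.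
have vk0 : 0 < vk by rewrite race_norm_gt0// mem_nth//; lia.
set u : R := 64 * _ in g.
have u0 : 0 < u by rewrite mulr_gt0// divr_gt0// ltr0n.
have g3 : 1 <= 3 * u `^ p^-1.
  rewrite -(ler_pM2l vk0) mulr1 (le_trans h)// mulrCA ler_wpM2l//.
have : 1 <= 9 * u.
  have [//|u9] := leP 1 (9 * u).
  have := g3; rewrite leNgt => /negP; case.
  (* Writing 3 as 9^(1/2), which is at most 9^(1/p), puts both factors under the same power 1/p. *)
  have -> : 3 = (9 : R) `^ 2^-1.
    have -> : (9 : R) = 3 ^+ 2 by ring.
    by rewrite -powR_mulrn// -powRrM divff// powRr1.
  apply: (@le_lt_trans _ _ (9 `^ p^-1 * u `^ p^-1)).
    by rewrite ler_wpM2r ?powR_ge0// ler_powR ?lef_pV2 ?posrE//; lra.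
  rewrite -powRM ?(ltW u0)//.
  have : (9 * u) `^ p^-1 < 1 `^ p^-1; last by rewrite powR1.
  have u90 : 0 <= 9 * u by rewrite mulr_ge0// ltW.
  by apply: gt0_ltr_powR; rewrite ?invr_gt0 ?nnegrE.
rewrite /u mulrA mulrA ler_pdivlMr ?ltr0n// mul1r -natrM -natrM ler_nat.
by lia.
Qed.

End good.
End race.
End ordered_transform.

Lemma in_bigsetU (I : eqType) (T : Type) (s : seq I) (Pr : pred I)
    (F : I -> set T) t :
  (\big[setU/set0]_(x <- s | Pr x) F x) t <->
  exists2 x, (x \in s) && Pr x & F x t.
Proof.
elim: s => [|y s IH]; first by rewrite big_nil; split=> // -[].
rewrite big_cons; split.
  case: ifP => [Py [Fy|/IH[x /andP[xs Px] Fx]]|_ /IH[x /andP[xs Px] Fx]].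
  - by exists y; rewrite // mem_head.
  - by exists x; rewrite // inE xs orbT.
  - by exists x; rewrite // inE xs orbT.
move=> [x /andP[]]; rewrite inE => /orP[/eqP->|xs] Px Fx.
  by rewrite Px; left.
have h : (\big[setU/set0]_(x <- s | Pr x) F x) t by apply/IH; exists x; rewrite ?xs.
by case: ifP => _ //; right.
Qed.

(** * Events determined by the order *)

Section order_events.
Context {R : realType} d (T : measurableType d) (P : probability T R).
Context (K : eqType) (r : K -> {RV P >-> R}) (lam : K -> R) (N : seq K).
Hypotheses (iid : iid_exp1 r) (uniqN : uniq N) (lam_gt0 : forall x, x \in N -> 0 < lam x).

Definition race_event (l : seq K) : set T :=
  [set t | race lam (r ^~ t) (rev l)].

Lemma measurable_race_event l : measurable (race_event l).
Proof.
have := @measurable_race_setU _ _ lam _ _ _ r (rev l) (fun=> true) (measurable_cst _).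
by under eq_set do rewrite andbT.
Qed.

Lemma race_exists t : (forall x, x \in N -> 0 < r x t / lam x) ->
  (forall x y, x \in N -> y \in N -> x != y -> r x t / lam x != r y t / lam y) ->
  exists2 l, l \in permutations N & race_event l t.
Proof.
move=> pos inj.
set a := fun x => r x t / lam x.
exists (sort (relpre a <=%R) N); first by rewrite mem_permutations perm_sort.
rewrite /race_event/= race_rev -/a -sort_map.
rewrite path_min_sorted; last first.
  by apply/allP => u; rewrite mem_sort => /mapP[x xN ->]; exact: pos.
rewrite lt_sorted_uniq_le sort_le_sorted andbT sort_uniq.
rewrite map_inj_in_uniq// => x y xN yN /eqP; apply: contraTeq => xy.
exact: inj.
Qed.

Lemma race_event_inj l l' t : l \in permutations N -> l' \in permutations N ->
  race_event l t -> race_event l' t -> l = l'.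
Proof.
rewrite !mem_permutations => lN l'N.
rewrite /race_event/= !race_rev => /path_sorted + /path_sorted.
rewrite !sorted_map => ls l's; apply: irr_sorted_eq ls l's _.
- by move=> x y z; exact: lt_trans.
- by move=> x; rewrite /= ltxx.
- by move=> x; rewrite (perm_mem lN) (perm_mem l'N).
Qed.

(** Ties and nonpositive arrivals are excluded by races of one or two keys. The race of a single key
    has mass 1, and the two races of x and y have masses lam x / (lam x + lam y) and lam y / (lam x
    + lam y). Outside finitely many null sets, sorting the arrivals yields a race. *)
Lemma race_events_setT : P (~` (\big[setU/set0]_(l <- permutations N) race_event l)) = 0%E.
Proof.
pose bad1 x := ~` race_event [:: x].
pose bad2 x y := ~` (race_event [:: x; y] `|` race_event [:: y; x]).
have mbad1 x : measurable (bad1 x) by apply: measurableC; exact: measurable_race_event.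
have mbad2 x y : measurable (bad2 x y).
  by apply: measurableC; apply: measurableU; exact: measurable_race_event.
have bad10 x : x \in N -> P (bad1 x) = 0%E.
  move=> xN; rewrite probability_setC; last exact: measurable_race_event.
  rewrite /race_event (race_prob iid)//; last first.
    by move=> y; rewrite mem_rev inE => /eqP->; exact: lam_gt0.
  by rewrite /= addr0 mulr1 divff ?subee// gt_eqF// lam_gt0.
have pair x y : x \in N -> y \in N -> x != y ->
    P (race_event [:: x; y]) = (race_mass lam 0 [:: y; x])%:E.
  move=> xN yN xy; rewrite /race_event (race_prob iid) /rev//=.
    by rewrite inE eq_sym xy.
  by move=> z; rewrite !inE => /orP[]/eqP->; exact: lam_gt0.
have bad20 x y : x \in N -> y \in N -> x != y -> P (bad2 x y) = 0%E.
  move=> xN yN xy.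
  rewrite probability_setC; last by apply: measurableU; exact: measurable_race_event.
  have lx := lam_gt0 xN; have ly := lam_gt0 yN.
  have -> : (P (race_event [:: x; y] `|` race_event [:: y; x]) =
      P (race_event [:: x; y]) + P (race_event [:: y; x]))%E.
    apply: measureU; try exact: measurable_race_event.
    rewrite -subset0 => t [] /=; rewrite /race_event/= /rev/= !andbT.
    by move=> /andP[h1 _] /andP[h2 _]; have := lt_trans h1 h2; rewrite ltxx.
  rewrite !pair// 1?eq_sym// -EFinD /= !addr0 !mulr1.
  transitivity (1 - 1%:E : \bar R)%E; last by rewrite subee.
  congr (1 - _%:E)%E; field.
  by rewrite !gt_eqF//= addr_gt0.
pose U := \big[setU/set0]_(x <- N) bad1 x `|`
  \big[setU/set0]_(x <- N) \big[setU/set0]_(y <- N | x != y) bad2 x y.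
have mU : measurable U.
  apply: measurableU; first exact: bigsetU_measurable.
  by apply: bigsetU_measurable => x _; apply: bigsetU_measurable.
have null_big (s : seq K) (Pr : pred K) (F : K -> set T) :
    (forall x, x \in s -> Pr x -> measurable (F x) /\ P (F x) = 0%E) ->
    P (\big[setU/set0]_(x <- s | Pr x) F x) = 0%E.
  move=> h; apply/eqP; rewrite -measure_le0 big_seq_cond.
  suff : measurable (\big[setU/set0]_(x <- s | (x \in s) && Pr x) F x) /\
    (P (\big[setU/set0]_(x <- s | (x \in s) && Pr x) F x) <= 0)%E by case.
  elim/big_ind : _ => [|A B [mA A0] [mB B0]|x /andP[xs Px]].
  - by rewrite measure0.
  - split; first exact: measurableU.
    by apply: (le_trans (measureU2 _ mA mB)); rewrite -(adde0 0%E) leeD.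
  - by have [mF ->] := h x xs Px.
have U0 : P U = 0%E.
  apply/eqP; rewrite -measure_le0.
  have mU1 : measurable (\big[setU/set0]_(x <- N) bad1 x) by exact: bigsetU_measurable.
  have mU2 : measurable
      (\big[setU/set0]_(x <- N) \big[setU/set0]_(y <- N | x != y) bad2 x y).
    by apply: bigsetU_measurable => x _; apply: bigsetU_measurable.
  have z1 : (P (\big[setU/set0]_(x <- N) bad1 x) <= 0)%E.
    by rewrite null_big// => x xN _; rewrite bad10.
  have z2 : (P (\big[setU/set0]_(x <- N) \big[setU/set0]_(y <- N | x != y) bad2 x y) <= 0)%E.
    rewrite null_big// => x xN _; split; first exact: bigsetU_measurable.
    by rewrite null_big// => y yN xy; rewrite bad20.
  by apply: (le_trans (measureU2 _ mU1 mU2)); rewrite -(adde0 0%E); exact: leeD z1 z2.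
apply/eqP; rewrite -measure_le0 -U0; apply: le_measure; rewrite ?inE//.
  by apply: measurableC; apply: bigsetU_measurable => l _; exact: measurable_race_event.
move=> t /= tU; apply: contrapT => tnU; apply: tU.
have bad1N x : x \in N -> race_event [:: x] t.
  move=> xN; apply: contrapT => h; apply: tnU; left.
  by apply/in_bigsetU; exists x; rewrite ?xN.
have bad2N x y : x \in N -> y \in N -> x != y ->
    (race_event [:: x; y] `|` race_event [:: y; x]) t.
  move=> xN yN xy; apply: contrapT => h; apply: tnU; right.
  apply/in_bigsetU; exists x; first by rewrite xN.
  by apply/in_bigsetU; exists y => //; rewrite yN.
have [l lN lt] : exists2 l, l \in permutations N & race_event l t.
  apply: race_exists => [x xN|x y xN yN xy].
    by have := bad1N x xN; rewrite /race_event/= andbT.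
  have [] := bad2N x y xN yN xy; rewrite /race_event/rev/= => /andP[+ _].
    by move/lt_eqF => ->.
  by move/gt_eqF => ->.
by apply/in_bigsetU; exists l; rewrite ?lN.
Qed.

(** An event [Q] determined by the order is, up to a null set, a disjoint union of races. The bound
    within each race sums to a bound relative to [P Q], whatever [Q] is; all the conditioning goes
    through this. *)
Lemma race_cond_bound k (Q B : set T) : measurable Q -> measurable B ->
  (forall l t t', l \in permutations N -> race_event l t -> race_event l t' ->
    Q t -> Q t') ->
  (forall l t, l \in permutations N -> race_event l t -> B t ->
    (k <= size l)%N /\ ~~ race_good lam k (r ^~ t) (rev l)) ->
  (P (Q `&` B) <= (2 * expR (- k%:R))%:E * P Q)%E.
Proof.
move=> mQ mB detQ badB.
set del := 2 * expR (- k%:R).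
have del0 : 0 <= del by rewrite mulr_ge0// expR_ge0.
have one l : l \in permutations N ->
  (P (Q `&` B `&` race_event l) <= del%:E * P (Q `&` race_event l))%E.
  move=> lN.
  have [[t0 [Qt0 lt0]]|none] := pselect (exists t, Q t /\ race_event l t); last first.
    rewrite (_ : _ `&` _ = set0) ?measure0 ?mule_ge0//.
    by rewrite -subset0 => t [[Qt _] lt]; apply: none; exists t.
  have QE : Q `&` race_event l = race_event l.
    by rewrite setIidr// => t lt; exact: detQ lt0 lt Qt0.
  have [kl|lk] := leqP k (size l); last first.
    rewrite (_ : _ `&` _ `&` _ = set0) ?measure0 ?mule_ge0//.
    by rewrite -subset0 => t [[_ Bt] lt]; have [] := badB l t lN lt Bt; lia.
  rewrite QE.
  have ul : uniq (rev l).
    by rewrite rev_uniq; move: lN; rewrite mem_permutations => /perm_uniq ->.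
  have laml x : x \in rev l -> 0 < lam x.
    move: lN; rewrite mem_permutations => lN.
    by rewrite mem_rev (perm_mem lN); exact: lam_gt0.
  apply: le_trans (race_good_concentration iid ul laml _); last by rewrite size_rev.
  apply: le_measure; rewrite ?inE.
  - apply: measurableI; last exact: measurable_race_event.
    exact: measurableI.
  - by apply: measurable_race_setU; apply: measurable_neg; exact: measurable_race_good.
  - by move=> t [[_ Bt] lt]; have [_ ng] := badB l t lN lt Bt; apply/andP.
have main L : uniq L -> {subset L <= permutations N} ->
  (P (Q `&` B `&` \big[setU/set0]_(l <- L) race_event l) <=
   del%:E * P (Q `&` \big[setU/set0]_(l <- L) race_event l))%E.
  elim: L => [|l L IH].
    by rewrite big_nil !setI0 !measure0 mule0.
  move=> /= /andP[lL uL] LN; rewrite big_cons !setIUr.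
  have mU : measurable (\big[setU/set0]_(l <- L) race_event l).
    by apply: bigsetU_measurable => l' _; exact: measurable_race_event.
  have mQB : measurable (Q `&` B) by exact: measurableI.
  apply: le_trans (measureU2 _ _ _) _.
  - by apply: measurableI => //; exact: measurable_race_event.
  - exact: measurableI.
  rewrite measureU; first last.
  - rewrite -subset0 => t [[_ lt] [_]].
    move=> /in_bigsetU[l']; rewrite andbT => l'L l't.
    have ll' : l = l'.
      by apply: race_event_inj lt l't; apply: LN; rewrite inE ?eqxx// l'L orbT.
    by move: lL; rewrite ll' l'L.
  - exact: measurableI.
  - by apply: measurableI => //; exact: measurable_race_event.
  rewrite ge0_muleDr//; apply: leeD; first by apply: one; apply: LN; rewrite mem_head.
  by apply: IH => // x xL; apply: LN; rewrite inE xL orbT.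
set U := \big[setU/set0]_(l <- permutations N) race_event l.
have mU : measurable U.
  by apply: bigsetU_measurable => l' _; exact: measurable_race_event.
have mQB : measurable (Q `&` B) by exact: measurableI.
apply: (@le_trans _ _ (P (Q `&` B `&` U))).
  rewrite -[X in (P X <= _)%E](setUIDK _ U).
  have mQBD : measurable (Q `&` B `\` U) by exact: measurableD.
  have mQBU : measurable (Q `&` B `&` U) by exact: measurableI.
  apply: (le_trans (measureU2 _ mQBU mQBD)).
  rewrite [X in (_ + X <= _)%E](_ : _ = 0%E) ?adde0//.
  apply/eqP; rewrite -measure_le0 -race_events_setT.
  by apply: le_measure; rewrite ?inE//; [exact: measurableC].
apply: le_trans (main _ (permutations_uniq _) (fun x xN => xN)) _.
rewrite lee_wpmul2l// le_measure ?inE//; exact: measurableI.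
Qed.

End order_events.

(** * Measurability of the order and of the two-pass method *)

Section decided.
Context d (Z : measurableType d).

(* [f] may be frozen to a constant when proving measurability: this is the form
   in which measurable functions with finitely many values compose. *)
Definition decided (X : Type) (f : Z -> X) : Prop :=
  forall Q : X -> set Z, (forall x, measurable (Q x)) ->
    measurable [set z | Q (f z) z].

Lemma decided_cst X (x : X) : decided (fun=> x).
Proof. by move=> Q; exact. Qed.

Lemma decided_bind X Y (f : Z -> X) (g : X -> Z -> Y) :
  decided f -> (forall x, decided (g x)) -> decided (fun z => g (f z) z).
Proof.
move=> df dg Q mQ.
by apply: (df (fun x => [set z | Q (g x z) z])) => x; exact: dg.
Qed.

Lemma decided_comp X Y (h : X -> Y) (f : Z -> X) :
  decided f -> decided (fun z => h (f z)).
Proof.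
by move=> df; apply: (decided_bind (g := fun x _ => h x) df) => x; exact: decided_cst.
Qed.

Lemma decided_bool (b : Z -> bool) : measurable_fun [set: Z] b -> decided b.
Proof.
move=> mb Q mQ.
have mt c : measurable (b @^-1` [set c]) by rewrite -[X in measurable X]setTI; exact: mb.
rewrite (_ : mkset _ = (b @^-1` [set true] `&` Q true) `|`
  (b @^-1` [set false] `&` Q false)).
  by apply: measurableU; exact: measurableI.
apply/seteqP; split=> z /=; case: (b z) => //; [by left|by right|by case=> -[]|by case=> -[]].
Qed.

Lemma decided_if X (b : Z -> bool) (f g : Z -> X) :
  decided b -> decided f -> decided g -> decided (fun z => if b z then f z else g z).
Proof.
move=> db df dg.
by apply: (decided_bind (g := fun c z => if c then f z else g z) db) => -[].
Qed.

Lemma decided_measurable (P : Z -> Prop) :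
  decided P -> measurable [set z | P z].
Proof.
move=> dP; apply: (dP (fun Q => [set z | Q])) => Q.
by have [q|nq] := pselect Q; [rewrite (_ : mkset _ = setT)|rewrite (_ : mkset _ = set0)];
  rewrite ?predeqE//.
Qed.

Section sort.
Context (X : Type) (cmp : Z -> rel X).
Hypothesis dcmp : forall a b, decided (fun z => cmp z a b).

Lemma decided_merge s1 s2 : decided (fun z => merge (cmp z) s1 s2).
Proof.
elim: s1 s2 => [|x1 s1 IH1] s2; first exact: decided_cst.
elim: s2 => [|x2 s2 IH2]; first exact: decided_cst.
apply: decided_if => //.
  exact: (decided_comp (cons x1) (IH1 (x2 :: s2))).
exact: (decided_comp (cons x2) IH2).
Qed.

(** [sortE] exposes the recursion of merge sort, in which each step either branches on one
    comparison or continues from a list that can be frozen. *)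
Lemma decided_sort s : decided (fun z => sort (cmp z) s).
Proof.
have dpush ss s1 : decided (fun z => merge_sort_push (cmp z) s1 ss).
  elim: ss s1 => [|s2 ss IH] s1; first exact: decided_cst.
  case: s2 => [|x s2]; first exact: decided_cst.
  apply: (decided_comp (cons [::])).
  exact: (decided_bind (g := fun u z => merge_sort_push (cmp z) u ss)
    (decided_merge (x :: s2) s1)).
have dpop ss s1 : decided (fun z => merge_sort_pop (cmp z) s1 ss).
  elim: ss s1 => [|s2 ss IH] s1; first exact: decided_cst.
  exact: (decided_bind (g := fun u z => merge_sort_pop (cmp z) u ss)
    (decided_merge s2 s1)).
suff h ss : decided (fun z => sort_rec1 (cmp z) ss s).
  by under eq_fun do rewrite sortE; exact: h.
elim: s ss => [|x s IH] ss; first exact: dpop.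
exact: (decided_bind (g := fun u z => sort_rec1 (cmp z) u s) (dpush ss [:: x])).
Qed.

End sort.
End decided.

Lemma sorted_filter_cat (X : Type) (leT : rel X) (p : pred X) (s : seq X) :
  transitive leT -> (forall x y, leT x y -> p y -> p x) -> sorted leT s ->
  s = [seq x <- s | p x] ++ [seq x <- s | ~~ p x].
Proof.
move=> tr up; elim: s => //= x s IH xs.
have {}IH := IH (path_sorted xs).
case: ifP => px; first by rewrite /= -IH.
have : all (fun y => ~~ p y) s.
  have := order_path_min tr xs; elim: (s) => //= y u IHu /andP[xy xu].
  by rewrite IHu// andbT; apply/negP => /(up _ _ xy); rewrite px.
move=> /all_filterP h; have p0 : [seq y <- s | p y] = [::].
  by apply: size0nil; have := congr1 size IH; rewrite size_cat h; lia.
by rewrite p0 h.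
Qed.

(** * The order of a vector with distinct nonzero magnitudes *)

Section order_vector.
Context {R : realType} {n : nat}.
Implicit Types (v : 'I_n -> R) (l : seq 'I_n).

Lemma perm_order v : perm_eq (order v) (enum 'I_n).
Proof. by rewrite /order perm_sort. Qed.

(** Ties occur only between zero entries, and the stable sort leaves these in index order. Hence the
    order of [v] depends on [l] alone, which makes order events unions of races. *)
Lemma order_strict v l : uniq l -> (forall i, (i \in l) = (v i != 0)) ->
  sorted (fun i j => `|v j| < `|v i|) l ->
  order v = l ++ [seq i <- enum 'I_n | v i == 0].
Proof.
move=> ul lv sl; rewrite /order.
set leT := fun i j => `|v j| <= `|v i|.
have tot : total leT by move=> i j; exact: le_total.
have tr : transitive leT by move=> i j k ij jk; exact: le_trans jk ij.
have up i j : leT i j -> v j != 0 -> v i != 0.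
  by rewrite /leT -!normr_gt0 => ij j0; exact: lt_le_trans ij.
rewrite [LHS](sorted_filter_cat tr up (sort_sorted tot _)) !(filter_sort tot tr).
congr (_ ++ _).
  have sl' : sorted leT l by apply: sub_sorted sl => i j; exact: ltW.
  rewrite -[RHS](sorted_sort tr sl').
  apply/perm_sort_inP.
  - by move=> i j _ _; exact: tot.
  - by move=> i j k _ _ _; exact: tr.
  - move=> i j; rewrite !mem_filter -!lv => /andP[il _] /andP[jl _] /andP[ij ji].
    have lt_tr : transitive (fun i j : 'I_n => `|v j| < `|v i|).
      by move=> a b c ab bc; exact: lt_trans bc ab.
    have h := sorted_ltn_index lt_tr sl.
    have [ltij|ltji|e] := ltngtP (index i l) (index j l).
      by have := h _ _ il jl ltij; rewrite ltNge -/(leT j i) ji.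
      by have := h _ _ jl il ltji; rewrite ltNge -/(leT i j) ij.
    by rewrite -(nth_index i il) e nth_index.
  - apply: uniq_perm => //; first by rewrite filter_uniq// enum_uniq.
    by move=> i; rewrite mem_filter mem_enum andbT lv.
rewrite (eq_filter (a2 := fun i => v i == 0)); last by move=> i; rewrite /= negbK.
apply: pairwise_sort.
set s := [seq i <- enum 'I_n | v i == 0].
have : all (fun i => v i == 0) s by exact: filter_all.
elim: s => [|i s IH] //= => /andP[i0 s0]; rewrite IH// andbT.
by apply/allP => j js; rewrite /leT (eqP (allP s0 j js)) normr0.
Qed.

Section ordered.
Variables (v : 'I_n -> R) (l : seq 'I_n).
Hypotheses (ul : uniq l) (lv : forall i, (i \in l) = (v i != 0))
  (sl : sorted (fun i j => `|v j| < `|v i|) l).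

Lemma lq_pow_tail_order q k : (0 < q)%N ->
  lq_pow q (tail k v) = \sum_(i <- drop k l) `|v i| ^+ q.
Proof.
move=> q0.
have E : order v = take k l ++ drop k l ++ [seq i <- enum 'I_n | v i == 0].
  by rewrite (order_strict ul lv sl) catA cat_take_drop.
rewrite /lq_pow; set F := fun i => `|tail k v i| ^+ q.
have := perm_order v; rewrite perm_sym => pE.
rewrite -big_enum/= (perm_big _ pE)/= -/F E !big_cat/= /F /tail.
have hT i : i \in take k l -> i \in take k (order v).
  rewrite (order_strict ul lv sl) take_cat; case: ltnP => // kl.
  by rewrite mem_cat => /mem_take ->.
rewrite big_seq big1 ?add0r; last first.
  by move=> i /hT ->; rewrite normr0 expr0n gtn_eqF.
rewrite [X in _ + X]big_seq [X in _ + X]big1 ?addr0; last first.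
  move=> i; rewrite mem_filter => /andP[/eqP vi _].
  by case: ifP; rewrite ?vi normr0 expr0n gtn_eqF.
rewrite big_seq [RHS]big_seq; apply: eq_bigr => i id.
have kl : (k < size l)%N.
  by rewrite ltnNge; apply/negP => lk; move: id; rewrite drop_oversize.
rewrite ifN// (order_strict ul lv sl) take_cat kl.
move: ul; rewrite -{1}(cat_take_drop k l) cat_uniq => /and3P[_ /hasPn h _].
exact: h.
Qed.

Lemma entry_order x0 k : (0 < k <= size l)%N -> entry v k = v (nth x0 l k.-1).
Proof.
move=> /andP[k0 kl]; have k1 : (k.-1 < size l)%N by lia.
rewrite /entry (order_strict ul lv sl) (nth_map x0) ?nth_cat ?k1//.
by rewrite size_cat; lia.
Qed.

End ordered.

Lemma lq_pow_ge0 q v : 0 <= lq_pow q v.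
Proof. by rewrite sumr_ge0// => i _; rewrite exprn_ge0. Qed.

Lemma lq_pow_tailS q k v : (0 < q)%N ->
  lq_pow q (tail k.+1 v) <= lq_pow q (tail k v).
Proof.
move=> q0; apply: ler_sum => i _; rewrite /tail.
case: ifPn => [_|]; first by rewrite normr0 expr0n gtn_eqF//= exprn_ge0.
case: ifPn => // ik; rewrite -(cat_take_drop k (take _ _)) take_takel//.
by rewrite mem_cat ik.
Qed.

End order_vector.

Lemma measurable_transform (R : realType) d (Z : measurableType d) (K : eqType) (p : R)
    (w : K -> R) (f : K -> Z -> R) x : measurable_fun [set: Z] (f x) ->
  measurable_fun [set: Z] (fun z => transform p w (f ^~ z) x).
Proof.
move=> mf; rewrite /transform; apply: measurable_funM => //.
under eq_fun do rewrite -powRN.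
by apply: (@measurableT_comp _ _ _ _ _ _ (@powR R ^~ (- p^-1)) _ (f x)) => //;
  exact: measurable_powR.
Qed.

(** * The lower bound on Psi *)

Section transformed_vector.
Context {R : realType} {K : eqType} {n : nat}.
Variables (p : R) (w rho : K -> R) (l : seq K) (h : K -> 'I_n) (vec : 'I_n -> R).
Hypotheses (p_gt0 : 0 < p) (ul : uniq l) (hl : {in l &, injective h})
  (w_neq0 : forall x, x \in l -> w x != 0)
  (racel : race (exp_rate p w) rho (rev l))
  (vecE : forall x, x \in l -> vec (h x) = transform p w rho x)
  (vec_supp : forall i, (i \in map h l) = (vec i != 0)).
Let v := transform p w rho.

Let uhl : uniq (map h l).
Proof. by rewrite map_inj_in_uniq. Qed.

Let sorted_hl : sorted (fun i j => `|vec j| < `|vec i|) (map h l).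
Proof.
case E : l => [//|x0 s]; rewrite -E.
apply/(sortedP (h x0)) => i; rewrite size_map => il.
have il' := ltnW il.
rewrite !(nth_map x0)// !vecE ?mem_nth//.
exact: (race_sorted p_gt0).
Qed.

Lemma size_support : (size l <= n)%N.
Proof.
rewrite -(size_map h) -[leqRHS]card_ord; have /card_uniqP <- := uhl.
exact: max_card.
Qed.

Lemma order_support :
  order vec = map h l ++ [seq i <- enum 'I_n | i \notin map h l].
Proof.
rewrite (order_strict uhl vec_supp sorted_hl); congr (_ ++ _).
by apply: eq_filter => i; rewrite vec_supp negbK.
Qed.

Lemma lq_pow_tail_support q k : (0 < q)%N -> (size l <= k)%N ->
  lq_pow q (tail k vec) = 0.
Proof.
move=> q0 lk; rewrite (lq_pow_tail_order uhl vec_supp sorted_hl)//.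
by rewrite drop_oversize ?size_map// big_nil.
Qed.

Lemma entry_support x0 k : (0 < k <= size l)%N ->
  entry vec k = v (nth x0 l k.-1).
Proof.
move=> kl; rewrite (entry_order uhl vec_supp sorted_hl (h x0)) ?size_map//.
have k1 : (k.-1 < size l)%N by lia.
by rewrite (nth_map x0)// vecE// mem_nth.
Qed.

Lemma lq_pow_tail_good x0 q k M : (0 < q)%N -> (0 < k < size l)%N ->
  race_good (exp_rate p w) k rho (rev l) ->
  (forall m, (k <= m <= n)%N -> 64 `^ (q%:R / p) *
    \sum_(k <= j < m) (k%:R / j.+1%:R) `^ (q%:R / p) <= M * k%:R) ->
  lq_pow q (tail k vec) <= M * k%:R * `|v (nth x0 l k.-1)| ^+ q.
Proof.
move=> q0 /andP[k0 kl] good bM.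
rewrite (lq_pow_tail_order uhl vec_supp sorted_hl)// -map_drop big_map.
have -> : \sum_(x <- drop k l) `|vec (h x)| ^+ q = \sum_(x <- drop k l) `|v x| ^+ q.
  by rewrite big_seq [RHS]big_seq; apply: eq_bigr => x /mem_drop xl; rewrite vecE.
apply: (le_trans (race_good_tail p_gt0 w_neq0 racel x0 k0 good q)).
rewrite mulrC ler_wpM2r ?exprn_ge0//; apply: bM.
by rewrite size_support (ltnW kl).
Qed.

End transformed_vector.

Section Psi_lower_bound.
Context {R : realType}.

Let decided_order d (Z : measurableType d) n (f : 'I_n -> Z -> R) :
  (forall i, measurable_fun [set: Z] (f i)) -> decided (fun z => order (f ^~ z)).
Proof.
move=> mf; apply: decided_sort => i j; apply: decided_bool.
by apply: measurable_fun_ler; exact: measurableT_comp.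
Qed.

Let measurable_rhh_ratio d (Z : measurableType d) n (f : 'I_n -> Z -> R) q k (c : R) :
  (forall i, measurable_fun [set: Z] (f i)) ->
  measurable [set z | (rhh_ratio q k (f ^~ z) <= c%:E)%E].
Proof.
move=> mf.
(* With the order frozen to [o], the tail norm and the k-th entry are measurable functions of
   [z]. *)
pose tl o z := \sum_(i < n) `|if i \in take k o then 0 else f i z| ^+ q.
pose en o z := nth 0 [seq f j z | j <- o] k.-1.
pose Q (o : seq 'I_n) := [set z | (tl o z != 0) && (k%:R * `|en o z| ^+ q / tl o z <= c)].
rewrite (_ : mkset _ = [set z | Q (order (f ^~ z)) z]).
  apply: (decided_order mf) => o.
  have mtl : measurable_fun [set: Z] (tl o).
    apply: measurable_sum => i; apply: measurable_funX; apply: measurableT_comp => //.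
    by case: (i \in take k o).
  have men : measurable_fun [set: Z] (en o).
    rewrite /en; elim: (o) (k.-1) => [|j o' IH] [|m] //=; exact: mf.
  rewrite -[X in measurable X]setTI.
  have : measurable_fun [set: Z] (fun z =>
      (tl o z != 0) && (k%:R * `|en o z| ^+ q / tl o z <= c)).
    apply: measurable_and.
      by apply: measurable_neg; exact: measurable_fun_eqr.
    apply: measurable_fun_ler => //; apply: measurable_funM.
      by apply: measurable_funM => //; apply: measurable_funX; exact: measurableT_comp.
    have tl0 z : 0 <= tl o z by rewrite sumr_ge0// => i _; rewrite exprn_ge0.
    under eq_fun do rewrite -powR_inv1//.
    by apply: (@measurableT_comp _ _ _ _ _ _ (@powR R ^~ (- 1)) _ (tl o)) => //;
      exact: measurable_powR.
  by move=> /(_ measurableT [set true]); rewrite setTI; apply.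
apply/funext => z; apply/propext; rewrite /Q/= /rhh_ratio.
rewrite -[lq_pow _ _]/(tl (order (f ^~ z)) z) -[entry _ _]/(en (order (f ^~ z)) z).
by case: ifPn => //=; rewrite ?lee_fin// leye_eq.
Qed.

(** On a good race the tail is at most M k |v_(k)|^q. Taking 1 / (1 + M) instead of 1 / M makes the
    ratio strictly larger than psi, as the event in [Psi] is not strict, and covers M = 0. *)
Lemma Psi_lower_bound (p : R) (q n k : nat) (M : R) : 0 < p -> (0 < q)%N -> (0 < k)%N ->
  0 <= M ->
  (forall m, (k <= m <= n)%N -> 64 `^ (q%:R / p) *
    \sum_(k <= j < m) (k%:R / j.+1%:R) `^ (q%:R / p) <= M * k%:R) ->
  (((1 + M)^-1)%:E <= Psi p q n k (3 * expR (- k%:R)))%E.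
Proof.
move=> p0 q0 k0 M0 bM; apply: ereal_sup_ubound => /=.
exists (1 + M)^-1 => // w pi d T P r iid; cbv zeta.
set Q := [set t | order _ = _]; set B := [set t | (rhh_ratio _ _ _ <= _)%E].
have M1 : 0 < 1 + M by rewrite ltr_wpDr.
have mr i : measurable_fun [set: T] (fun t => transform p w (r ^~ t) i).
  exact: measurable_transform.
have mB : measurable B by exact: measurable_rhh_ratio.
have mQ : measurable Q.
  apply: decided_measurable; apply: (decided_comp (fun o => o = codom pi)).
  exact: decided_order.
pose N := [seq i <- enum 'I_n | w i != 0].
have uN : uniq N by rewrite filter_uniq// enum_uniq.
have memN i : (i \in N) = (w i != 0) by rewrite mem_filter mem_enum andbT.
have lam0 i : i \in N -> 0 < exp_rate p w i by rewrite memN => /exp_rate_gt0; apply.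
have suppl l t : l \in permutations N -> race_event r (exp_rate p w) l t ->
    [/\ uniq l, forall i, i \in l -> w i != 0 &
      forall i, (i \in map id l) = (transform p w (r ^~ t) i != 0)].
  rewrite mem_permutations => lN lt.
  have wl i : (i \in l) = (w i != 0) by rewrite (perm_mem lN) memN.
  split; [by rewrite (perm_uniq lN)|by move=> i; rewrite wl|move=> i; rewrite map_id].
  apply/idP/idP => [il|].
    rewrite -normr_gt0; apply: (race_norm_gt0 p0 _ lt il) => j; by rewrite wl.
  by rewrite wl; apply: contraNneq => wi; rewrite /transform wi mul0r.
have key : (P (Q `&` B) <= (2 * expR (- k%:R))%:E * P Q)%E.
  apply: (race_cond_bound iid uN lam0 mQ mB).
  - move=> l t t' lN lt lt'.
    have [ul wl supp] := suppl l t lN lt; have [_ _ supp'] := suppl l t' lN lt'.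
    have hl : {in l &, injective (@id 'I_n)} by [].
    rewrite /Q/= (order_support p0 ul hl wl lt _ supp)//.
    by rewrite (order_support p0 ul hl wl lt' _ supp').
  - move=> l t lN lt Bt; have [ul wl supp] := suppl l t lN lt.
    have hl : {in l &, injective (@id 'I_n)} by [].
    have vE i : i \in l -> transform p w (r ^~ t) (id i) = transform p w (r ^~ t) i by [].
    (* With at most k nonzero entries the tail vanishes and the ratio is infinite, so the bad event
       does not occur. *)
    have [lk|kl] := leqP (size l) k.
      move: Bt; rewrite /B/= /rhh_ratio (lq_pow_tail_support p0 ul hl wl lt vE supp)//.
      by rewrite eqxx leye_eq.
    split; first exact: ltnW.
    apply/negP => good; move: Bt; rewrite /B/= /rhh_ratio.
    case: ifPn => [_|tl0]; first by rewrite leye_eq.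
    have [x0 _] : exists x0 : 'I_n, x0 \in l.
      by case: (l) kl => // x0 s _; exists x0; rewrite mem_head.
    have kl' : (0 < k < size l)%N by rewrite k0.
    have := lq_pow_tail_good p0 ul hl wl lt vE supp x0 q0 kl' good bM.
    rewrite (entry_support p0 ul hl wl lt vE supp x0); last by rewrite k0 ltnW.
    set tl := lq_pow _ _ in tl0 *; set vk := `|_| ^+ q.
    have tl00 : 0 < tl by rewrite lt_neqAle eq_sym tl0 lq_pow_ge0.
    move=> tle; rewrite lee_fin leNgt => /negP; apply.
    rewrite ltr_pdivlMr// mulrC -ltr_pdivlMr ?invr_gt0// invrK.
    have kv : 0 < k%:R * vk.
      rewrite mulr_gt0 ?ltr0n// exprn_gt0//; apply: (race_norm_gt0 p0 wl lt).
      by rewrite mem_nth//; lia.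
    lra.
rewrite /cprob setIC.
have PQB := fin_num_measure P _ (measurableI _ _ mQ mB).
have PQ := fin_num_measure P _ mQ.
have e0 := expR_gt0 (- k%:R : R).
(* An order of probability 0 has conditional probability 0 by the convention in [cprob]. *)
have [->|PQ0] := eqVneq (fine (P Q)) 0; first by rewrite invr0 mulr0 mulr_ge0// ltW.
have PQ1 : 0 < fine (P Q) by rewrite lt_neqAle eq_sym PQ0 fine_ge0.
rewrite ler_pdivrMr//; move: key; rewrite -(fineK PQB) -(fineK PQ) -EFinM lee_fin => key.
by apply: (le_trans key); rewrite ler_wpM2r ?fine_ge0// ler_wpM2r ?expR_ge0// ler_nat.
Qed.

End Psi_lower_bound.

(** * Correctness of the two-pass method *)

Section top_structure.
Context {R : realType} {K : eqType}.
Variables (pr : K -> R) (h : K -> nat) (m : nat).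
Implicit Types (x y : K) (X S : seq K) (s : seq (K * R)).

(** The strict part of [beats_or_ties], the comparison made by [top_prune]. Where [h] is injective,
    the two agree on distinct keys. *)
Definition beats x y := (pr y < pr x) || (pr y == pr x) && (h x < h y)%N.

Definition beats_or_ties x y :=
  (pr y < pr x) || (pr y == pr x) && (h x <= h y)%N.

(** The position of [y] in the sorted list: being kept becomes [rank < m], a condition that does not
    depend on how the dataset was assembled. *)
Definition rank y X := count (beats ^~ y) X.

Lemma beats_trans : transitive beats.
Proof.
move=> y x z /orP[xy|/andP[/eqP xy hxy]] /orP[yz|/andP[/eqP yz hyz]]; apply/orP.
- by left; exact: lt_trans xy.
- by left; rewrite yz.
- by left; rewrite -xy.
- by right; rewrite yz xy eqxx (ltn_trans hxy).
Qed.

Lemma beats_irr : irreflexive beats.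
Proof. by move=> x; rewrite /beats ltxx ltnn andbF. Qed.

Lemma beats_or_ties_trans : transitive beats_or_ties.
Proof.
move=> y x z /orP[xy|/andP[/eqP xy hxy]] /orP[yz|/andP[/eqP yz hyz]]; apply/orP.
- by left; exact: lt_trans xy.
- by left; rewrite yz.
- by left; rewrite -xy.
- by right; rewrite yz xy eqxx (leq_trans hxy).
Qed.

Lemma beats_or_ties_total : total beats_or_ties.
Proof.
move=> x y; rewrite /beats_or_ties; case: (ltgtP (pr x) (pr y)) => //= _.
exact: leq_total.
Qed.

Lemma index_sorted_beats x X : sorted beats X -> x \in X -> index x X = rank x X.
Proof.
elim: X => //= y X IH yX; rewrite inE => /orP[/eqP->|xX].
  rewrite eqxx beats_irr add0n; apply/esym/eqP; rewrite -leqn0 leqNgt -has_count.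
  apply/hasPn => z zX; apply/negP => zy.
  have := allP (order_path_min beats_trans yX) z zX.
  by move=> /(beats_trans zy); rewrite beats_irr.
have yx : beats y x by exact: (allP (order_path_min beats_trans yX)).
rewrite yx add1n; case: eqP => [e|_]; first by rewrite e beats_irr in yx.
by rewrite (IH (path_sorted yX)).
Qed.

Section injective_hash.
Variable D : seq K.
Hypothesis hD : {in D &, injective h}.

Lemma sort_beats X : uniq X -> {subset X <= D} -> sorted beats (sort beats_or_ties X).
Proof.
move=> uX XD.
have := sort_sorted beats_or_ties_total X.
rewrite (sorted_pairwise beats_or_ties_trans) => h1.
have : uniq (sort beats_or_ties X) by rewrite sort_uniq.
rewrite uniq_pairwise => h2.
have : pairwise [rel x y | beats_or_ties x y && (x != y)] (sort beats_or_ties X).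
  by rewrite pairwise_relI h1 h2.
move=> h3; apply: pairwise_sorted.
have allD : all (mem D) (sort beats_or_ties X).
  by apply/allP => x; rewrite mem_sort => /XD.
apply: sub_in_pairwise allD h3 => x y xD yD /= /andP[/orP[xy|/andP[xy hxy]] nxy].
  by rewrite /beats xy.
rewrite /beats xy /= ltn_neqAle hxy andbT orbC.
by apply/orP; left; apply: contra nxy => /eqP /(hD xD yD) ->.
Qed.

Lemma mem_take_sort X x : uniq X -> {subset X <= D} ->
  (x \in take m (sort beats_or_ties X)) = (x \in X) && (rank x X < m)%N.
Proof.
move=> uX XD.
have rE : rank x X = rank x (sort beats_or_ties X).
  by rewrite /rank count_sort.
have [xX|xX] := boolP (x \in X); last first.
  by apply/negbTE; apply: contra xX => /mem_take; rewrite mem_sort.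
rewrite in_take ?mem_sort// rE index_sorted_beats ?mem_sort//.
exact: sort_beats.
Qed.

Lemma rank_sub x S X : uniq S -> {subset S <= X} -> (rank x S <= rank x X)%N.
Proof.
move=> uS SX; rewrite /rank -!size_filter; apply: uniq_leq_size.
  exact: filter_uniq.
by move=> y; rewrite !mem_filter => /andP[-> /SX ->].
Qed.

(* The [m] best of the keys beating [x] are among the [m] best of all keys. *)
Lemma rank_top x S X : uniq S -> uniq X -> {subset X <= D} -> {subset S <= X} ->
  (forall y, y \in X -> (rank y X < m)%N -> y \in S) ->
  (rank x S < m)%N = (rank x X < m)%N.
Proof.
move=> uS uX XD SX topS; apply/idP/idP; last first.
  by apply: leq_ltn_trans; exact: rank_sub.
apply: contraTT; rewrite -!leqNgt => mX.
pose B := [seq y <- X | beats y x].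
have uB : uniq B by exact: filter_uniq.
have BD : {subset B <= D} by move=> y; rewrite mem_filter => /andP[_ /XD].
have sB : (m <= size B)%N by rewrite size_filter.
have -> : m = size (take m (sort beats_or_ties B)) by rewrite size_takel ?size_sort.
rewrite /rank -size_filter; apply: uniq_leq_size.
  by rewrite take_uniq// sort_uniq.
move=> y; rewrite (mem_take_sort _ uB BD) [y \in B]mem_filter => /andP[/andP[yx yX] ry].
rewrite mem_filter yx/=; apply: topS => //.
apply: leq_ltn_trans ry; rewrite /rank -!size_filter; apply: uniq_leq_size.
  exact: filter_uniq.
move=> z; rewrite !mem_filter => /andP[zy zX].
by rewrite zy zX (beats_trans zy yx).
Qed.

Lemma unzip1_top_prune s :
  unzip1 (top_prune pr h m s) = take m (sort beats_or_ties (unzip1 s)).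
Proof.
by rewrite /unzip1 (sort_map (f := fst) (leT := beats_or_ties)) /top_prune map_take.
Qed.

Lemma top_prune_sub s : {subset top_prune pr h m s <= s}.
Proof. by move=> e /mem_take; rewrite mem_sort. Qed.

Lemma freq_cat s1 s2 x : freq (s1 ++ s2) x = freq s1 x + freq s2 x.
Proof. by rewrite /freq big_cat. Qed.

Lemma freq_cons e s x : freq (e :: s) x = (if e.1 == x then e.2 else 0) + freq s x.
Proof. by rewrite /freq big_cons; case: ifP => _; rewrite ?add0r. Qed.

Lemma freq_notin s x : x \notin unzip1 s -> freq s x = 0.
Proof.
move=> xs; rewrite /freq big_seq_cond big1// => e /andP[es /eqP ex].
by move: xs; rewrite -ex (map_f fst es).
Qed.

Lemma freq_uniq s e : uniq (unzip1 s) -> e \in s -> e.2 = freq s e.1.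
Proof.
elim: s => // a s IH /= /andP[as_ us]; rewrite inE => /orP[/eqP->|es].
  by rewrite freq_cons eqxx freq_notin// addr0.
rewrite freq_cons -(IH us es) ifN ?add0r//.
by apply: contraNneq as_ => ->; exact: map_f.
Qed.

Lemma freq_top_update s e x : freq (top_update s e) x = freq s x + freq [:: e] x.
Proof.
elim: s => [|a s IH] /=; first by rewrite [freq [::] x]freq_notin ?add0r.
case: eqP => [ae|_]; last by rewrite 2!(freq_cons a) IH addrA.
rewrite !freq_cons/=.
rewrite [freq [::] x]freq_notin// ae.
by case: ifP => _; ring.
Qed.

Lemma mem_top_update s e x :
  (x \in unzip1 (top_update s e)) = (x \in unzip1 s) || (x == e.1).
Proof.
elim: s => [|a s IH] /=; first by rewrite !inE.
case: eqP => [ae|_] /=; rewrite !inE; last by rewrite IH orbA.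
by rewrite -ae; case: eqP; rewrite ?orbT ?orbF.
Qed.

Lemma uniq_top_update s e : uniq (unzip1 s) -> uniq (unzip1 (top_update s e)).
Proof.
elim: s => //= a s IH /andP[as_ us]; case: eqP => [ae|ae] /=; first by rewrite as_.
by rewrite IH// mem_top_update negb_or as_ andbT; apply/eqP.
Qed.

Lemma freq_foldl_update s s' x :
  freq (foldl (@top_update R K) s s') x = freq s x + freq s' x.
Proof.
elim: s' s => [|e s' IH] s /=; first by rewrite [freq [::] x]freq_notin// addr0.
by rewrite IH freq_top_update !freq_cons [freq [::] x]freq_notin//; ring.
Qed.

Lemma mem_foldl_update s s' x :
  (x \in unzip1 (foldl (@top_update R K) s s')) = (x \in unzip1 s) || (x \in unzip1 s').
Proof.
elim: s' s => [|e s' IH] s /=; first by rewrite orbF.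
by rewrite IH mem_top_update inE orbA.
Qed.

Lemma uniq_foldl_update s s' : uniq (unzip1 s) ->
  uniq (unzip1 (foldl (@top_update R K) s s')).
Proof. by elim: s' s => //= e s' IH s us; apply: IH; exact: uniq_top_update. Qed.

Definition is_top_of s (E : seq (K * R)) : Prop :=
  [/\ uniq (unzip1 s),
      forall x, (x \in unzip1 s) =
        (x \in unzip1 E) && (rank x (undup (unzip1 E)) < m)%N &
      forall e, e \in s -> e.2 = freq E e.1].

Lemma is_top_of_freq s E x : is_top_of s E ->
  (rank x (undup (unzip1 E)) < m)%N -> freq s x = freq E x.
Proof.
move=> [us ms fs] rx; have [xE|xE] := boolP (x \in unzip1 E); last first.
  by rewrite !freq_notin// ms (negbTE xE).
have /mapP[e es ->] : x \in unzip1 s by rewrite ms xE.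
by rewrite -fs// -freq_uniq.
Qed.

Lemma is_top_of_prune s E' : {subset unzip1 E' <= D} -> uniq (unzip1 s) ->
  {subset unzip1 s <= unzip1 E'} ->
  (forall x, x \in unzip1 E' -> (rank x (undup (unzip1 E')) < m)%N -> x \in unzip1 s) ->
  (forall x, (rank x (undup (unzip1 E')) < m)%N -> freq s x = freq E' x) ->
  is_top_of (top_prune pr h m s) E'.
Proof.
move=> ED us sE tops fs.
have sD : {subset unzip1 s <= D} by move=> x /sE /ED.
have up : uniq (unzip1 (top_prune pr h m s)).
  by rewrite unzip1_top_prune take_uniq// sort_uniq.
have rE x : (rank x (unzip1 s) < m)%N = (rank x (undup (unzip1 E')) < m)%N.
  apply: rank_top; rewrite ?undup_uniq//.
  - by move=> y; rewrite mem_undup => /ED.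
  - by move=> y /sE; rewrite mem_undup.
  - by move=> y; rewrite mem_undup; exact: tops.
have mp x : (x \in unzip1 (top_prune pr h m s)) =
    (x \in unzip1 E') && (rank x (undup (unzip1 E')) < m)%N.
  rewrite unzip1_top_prune mem_take_sort// rE.
  apply/idP/idP => /andP[xs rx]; rewrite rx andbT; [exact: sE|exact: tops].
split=> // e ep.
have : e.1 \in unzip1 (top_prune pr h m s) by exact: map_f.
rewrite mp => /andP[_ /fs <-].
by apply: freq_uniq => //; exact: top_prune_sub.
Qed.

(** Ranks only grow with the dataset. A key among the m best of the final dataset was therefore
    among the m best of every part containing it, and none of its frequency was ever discarded. *)
Lemma run_top_sketch (t : assembly (K * R)) : {subset unzip1 (elements t) <= D} ->
  is_top_of (run (top_sketch pr h m) t) (elements t).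
Proof.
have rank_le x X X' : {subset X <= X'} -> (rank x (undup X) <= rank x (undup X'))%N.
  by move=> XX'; apply: rank_sub; rewrite ?undup_uniq// => y; rewrite !mem_undup; exact: XX'.
elim: t => [|t IH e|t1 IH1 t2 IH2] /= ED.
- by split.
- have E1 : {subset unzip1 (elements t) <= unzip1 (rcons (elements t) e)}.
    by move=> x; rewrite /unzip1 map_rcons mem_rcons inE => ->; rewrite orbT.
  have {}IH := IH (fun x xt => ED x (E1 x xt)).
  have [us ms fs] := IH.
  apply: is_top_of_prune => //.
  + exact: uniq_top_update.
  + move=> x; rewrite mem_top_update ms /unzip1 map_rcons mem_rcons inE.
    by move=> /orP[/andP[-> _]|->]; rewrite ?orbT.
  + move=> x xE rx; rewrite mem_top_update ms.
    move: xE; rewrite {1}/unzip1 map_rcons mem_rcons inE => /orP[->|xE].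
      by rewrite orbT.
    by rewrite [_ \in _]xE/= (leq_ltn_trans (rank_le _ _ _ E1) rx).
  + move=> x rx; rewrite freq_top_update -cats1 freq_cat (is_top_of_freq IH)//.
    exact: leq_ltn_trans (rank_le _ _ _ E1) rx.
- have E1 : {subset unzip1 (elements t1) <= unzip1 (elements t1 ++ elements t2)}.
    by move=> x; rewrite /unzip1 map_cat mem_cat => ->.
  have E2 : {subset unzip1 (elements t2) <= unzip1 (elements t1 ++ elements t2)}.
    by move=> x; rewrite /unzip1 map_cat mem_cat => ->; rewrite orbT.
  have {}IH1 := IH1 (fun x xt => ED x (E1 x xt)).
  have {}IH2 := IH2 (fun x xt => ED x (E2 x xt)).
  have [us1 ms1 fs1] := IH1; have [us2 ms2 fs2] := IH2.
  apply: is_top_of_prune => //.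
  + exact: uniq_foldl_update.
  + by move=> x; rewrite mem_foldl_update ms1 ms2 => /orP[/andP[/E1]|/andP[/E2]].
  + move=> x; rewrite {1}/unzip1 map_cat mem_cat mem_foldl_update ms1 ms2.
    move=> /orP[] xE rx; rewrite -/(unzip1 _) in xE; rewrite xE/=.
      by rewrite (leq_ltn_trans (rank_le _ _ _ E1) rx).
    by rewrite (leq_ltn_trans (rank_le _ _ _ E2) rx) orbT.
  + move=> x rx; rewrite freq_foldl_update freq_cat.
    by rewrite (is_top_of_freq IH1) ?(is_top_of_freq IH2)//;
      [exact: leq_ltn_trans (rank_le _ _ _ E2) rx|exact: leq_ltn_trans (rank_le _ _ _ E1) rx].
Qed.

End injective_hash.

Lemma size_run_top_sketch (t : assembly (K * R)) :
  (size (run (top_sketch pr h m) t) <= m)%N.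
Proof. by case: t => [|t e|t1 t2] //=; rewrite /top_prune size_take_min geq_minl. Qed.

End top_structure.

Lemma perm_freq (R : realType) (K : eqType) (E E' : seq (K * R)) :
  perm_eq E E' -> freq E = freq E'.
Proof. by move=> EE'; apply/funext => x; exact: perm_big. Qed.

Lemma is_ppswor_sample_perm (R : realType) (K : eqType) (p : R) k
    (E E' : seq (K * R)) rho S : perm_eq E E' ->
  is_ppswor_sample p k E rho S -> is_ppswor_sample p k E' rho S.
Proof.
move=> EE'; have mE : unzip1 E =i unzip1 E' by apply/perm_mem/perm_map.
rewrite /is_ppswor_sample (perm_freq EE') => -[[uS SE sS topS] SS]; split=> //.
split=> //; first by move=> x /SE; rewrite mE.
  by rewrite sS (perm_size (perm_undup mE)).
by move=> x y xS; rewrite -mE; exact: topS.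
Qed.

(** * The sample extracted from the stored keys *)

Section sample.
Context {R : realType} {K : eqType} (p : R) (k m : nat) (h : K -> nat).
Variables (t : assembly (K * R)) (rho est : K -> R).
Let E := elements t.
Let D := unzip1 E.
Let v := transform p (freq E) rho.
Hypotheses (hD : {in D &, injective h}) (km : (k <= m)%N).

Let pr x := `|est x|.
Let s := run (top_sketch pr h m) t.
Let mag (e : K * R) := `|e.2 / rho e.1 `^ p^-1|.
Let S := take k (sort (fun a b => mag b <= mag a) s).

Let s_top : is_top_of pr h m s E.
Proof. exact: (run_top_sketch _ _ hD). Qed.

Let us : uniq (unzip1 s). Proof. by case: s_top. Qed.

Let mem_s x : (x \in unzip1 s) = (x \in D) && (rank pr h x (undup D) < m)%N.
Proof. by case: s_top. Qed.

Let magE e : e \in s -> mag e = `|v e.1|.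
Proof. by move=> es; case: s_top => _ _ fs; rewrite /mag (fs e es). Qed.

Let mem_S e : e \in S -> e \in s.
Proof. by move=> /mem_take; rewrite mem_sort. Qed.

Let uS : uniq (unzip1 S).
Proof.
rewrite /unzip1 map_take take_uniq// (perm_uniq (s2 := unzip1 s))//.
by apply: perm_map; rewrite perm_sort.
Qed.

Let size_S : size S = minn k (size (undup D)).
Proof.
have uD := undup_uniq D.
have DD : {subset undup D <= D} by move=> x; rewrite mem_undup.
have : perm_eq (unzip1 s) (take m (sort (beats_or_ties pr h) (undup D))).
  apply: uniq_perm => //; first by rewrite take_uniq// sort_uniq.
  by move=> x; rewrite mem_s (mem_take_sort _ _ hD)// mem_undup.
move=> /perm_size; rewrite size_map size_take_min size_sort => ss.
by rewrite size_take_min size_sort ss minnA (minn_idPl km).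
Qed.

Let top_stored x y : x \in unzip1 S -> y \in unzip1 s -> y \notin unzip1 S ->
  `|v y| <= `|v x|.
Proof.
move=> /mapP[e eS ->] /mapP[e' es' ->] yS; set le := fun a b => mag b <= mag a.
have tot : total le by move=> a b; exact: le_total.
have tr : transitive le by move=> a b c ab bc; exact: le_trans bc ab.
have := sort_sorted tot s; rewrite (sorted_pairwise tr).
rewrite -(cat_take_drop k (sort le s)) pairwise_cat => /andP[/allrelP al _].
rewrite -!magE//; last exact: mem_S.
apply: al => //.
have : e' \in sort le s by rewrite mem_sort.
rewrite -{1}(cat_take_drop k (sort le s)) mem_cat => /orP[|//].
by move=> /(map_f fst); rewrite -[take _ _]/S => h'; move: yS; rewrite h'.
Qed.

Let not_stored x y : x \in unzip1 s -> y \in D -> y \notin unzip1 s ->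
  pr y <= pr x.
Proof.
rewrite !mem_s => /andP[xD rx] yD; rewrite yD/= -leqNgt => ry.
rewrite leNgt; apply/negP => xy.
have : (m <= rank pr h x (undup D))%N.
  apply: (leq_trans ry); apply: sub_count => z zy.
  by apply: beats_trans zy _; rewrite /beats xy.
by rewrite leqNgt rx.
Qed.

Let sample_of_top :
  (forall x y, x \in unzip1 S -> y \in D -> y \notin unzip1 s -> `|v y| <= `|v x|) ->
  is_ppswor_sample p k E rho S.
Proof.
move=> h1; split; last first.
  rewrite -map_comp -[LHS]map_id; apply/eq_in_map => e /mem_S es /=.
  by case: s_top => _ _ fs; rewrite -fs//; case: (e).
split => //.
- move=> x /mapP[e /mem_S es ->].
  by have := mem_s e.1; rewrite map_f// => /esym/andP[].
- by rewrite size_map size_S.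
- move=> x y xS yD yS; have [ys|ys] := boolP (y \in unzip1 s).
    exact: top_stored.
  exact: h1.
Qed.

(** Serves the case of at most k nonzero frequencies, where the residual tail is zero and there is
    no positive k-th magnitude to measure errors against. *)
Lemma sample_exact : (forall x, x \in D -> est x = v x) ->
  is_ppswor_sample p k E rho S.
Proof.
move=> ex; apply: sample_of_top => x y /mapP[e /mem_S es ->] yD ys.
have xs : e.1 \in unzip1 s by exact: map_f.
have xD : e.1 \in D by move: xs; rewrite mem_s => /andP[].
by rewrite -!ex//; exact: not_stored.
Qed.

(* A key of magnitude at least [tau] is estimated above [2 tau / 3], hence it is
   only beaten by keys of magnitude at least [tau / 3]. *)
Lemma sample_approx (tau : R) (L : seq K) : uniq L -> {subset L <= D} ->
  size L = k -> (forall x, x \in L -> tau <= `|v x|) ->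
  (forall y, y \in D -> y \notin L -> `|v y| <= tau) ->
  (forall x, x \in D -> `|est x - v x| <= tau / 3) ->
  (size [seq x <- undup D | (tau <= 3 * `|v x|)%R] <= m)%N ->
  is_ppswor_sample p k E rho S.
Proof.
move=> uL LD sL tauL tauNL err cnt.
have tau0 x : x \in D -> 0 <= tau.
  by move=> /err; have := normr_ge0 (est x - v x); lra.
have Ls z : z \in L -> z \in unzip1 s.
  move=> zL; have zD := LD _ zL; rewrite mem_s zD/= ltnNge; apply/negP => mr.
  set B := [seq x <- undup D | beats pr h x z].
  (* If [z] were not stored, at least [m] keys would beat it, giving with [z] more than [m] keys of
     magnitude at least tau / 3. *)
  have : (size (z :: B) <= m)%N.
    apply: leq_trans cnt; apply: uniq_leq_size.
      rewrite /= mem_filter beats_irr/= filter_uniq// undup_uniq//.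
    move=> x; rewrite inE mem_filter => /orP[/eqP->|].
      rewrite mem_undup zD andbT; have := tauL z zL; have := tau0 z zD; lra.
    rewrite mem_filter mem_undup => /andP[xz xD]; rewrite xD andbT.
    have prx : pr z <= pr x by case/orP: xz => [/ltW//|/andP[/eqP-> _]].
    have e1 := err x xD; have e2 := err z zD; have e3 := tauL z zL.
    have e4 := ler_normD (v x) (est x - v x); have e5 := ler_normD (est z) (v z - est z).
    rewrite distrC in e2.
    rewrite /pr in prx; rewrite [_ + (_ - _)]addrC subrK in e4.
    rewrite [_ + (_ - _)]addrC subrK in e5.
    lra.
  by rewrite /= size_filter; apply/negP; rewrite -ltnNge.
apply: sample_of_top => x y xS yD ys.
have yL : y \notin L by apply: contra ys; exact: Ls.
apply: (le_trans (tauNL y yD yL)); rewrite leNgt; apply/negP => xtau.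
have xL : x \notin L by apply/negP => /tauL; rewrite leNgt xtau.
(* A sampled [x] below [tau] would rank under every key of [L], all of them stored; the sample would
   contain [x] and the [k] keys of [L]. *)
have LS : {subset L <= unzip1 S}.
  move=> z zL; apply/negPn/negP => zS.
  have := top_stored xS (Ls z zL) zS; have := tauL z zL; lra.
have : (size (x :: L) <= size (unzip1 S))%N.
  apply: uniq_leq_size; first by rewrite /= xL.
  by move=> z; rewrite inE => /orP[/eqP->//|/LS].
by rewrite /= sL size_map size_S leqNgt ltnS geq_minl.
Qed.

End sample.

Lemma elements_amap (E F : Type) (f : E -> F) (t : assembly E) :
  elements (amap f t) = map f (elements t).
Proof.
by elim: t => //= [t -> e|t1 -> t2 ->]; rewrite ?map_rcons ?map_cat.
Qed.

(** * Recovery of the top keys on the good event *)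

Section two_pass_correct.
Context {R : realType} {n : nat} {K : eqType}.
Variables (p : R) (q k : nat) (M : R) (KeyHash : K -> 'I_n) (A : est_sketch R n).
Variables (t1 t2 : assembly (K * R)) (rho : K -> R) (theta : seed A).
Let E := elements t2.
Let D := unzip1 E.
Let w := freq E.
Let v := transform p w rho.
Let vec := freq (elements (pass1_data p KeyHash t1 rho)).
Variable l : seq K.
Hypotheses (p_gt0 : 0 < p) (p_le2 : p <= 2) (q_gt0 : (0 < q)%N) (k_gt0 : (0 < k)%N)
  (M_ge0 : 0 <= M)
  (boundM : forall m, (k <= m <= n)%N -> 64 `^ (q%:R / p) *
    \sum_(k <= j < m) (k%:R / j.+1%:R) `^ (q%:R / p) <= M * k%:R)
  (t12 : perm_eq (elements t1) E)
  (injKH : {in D &, injective KeyHash})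
  (lN : perm_eq l [seq x <- undup D | w x != 0])
  (racel : race (exp_rate p w) rho (rev l))
  (goodl : (k < size l)%N -> race_good (exp_rate p w) k rho (rev l)).

Let vec_data i : vec i = \sum_(e <- E | KeyHash e.1 == i) e.2 / rho e.1 `^ p^-1.
Proof.
by rewrite /vec /freq /pass1_data elements_amap big_map (perm_big _ t12).
Qed.

Let vec_hash x : x \in D -> vec (KeyHash x) = v x.
Proof.
move=> xD; rewrite vec_data /v /transform /w /freq mulr_suml.
rewrite big_seq_cond [RHS]big_seq_cond; apply: eq_big => [e|e /andP[eE /eqP/injKH ->]//].
  case: (boolP (e \in E)) => //= eE; apply/eqP/eqP => [|->//].
  by apply: injKH => //; exact: map_f.
exact: map_f.
Qed.

Let mem_l x : (x \in l) = (x \in D) && (w x != 0).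
Proof. by rewrite (perm_mem lN) mem_filter mem_undup andbC. Qed.

Let l_sub x : x \in l -> x \in D.
Proof. by rewrite mem_l => /andP[]. Qed.

Let w_neq0 x : x \in l -> w x != 0.
Proof. by rewrite mem_l => /andP[]. Qed.

Let ul : uniq l.
Proof. by rewrite (perm_uniq lN) filter_uniq// undup_uniq. Qed.

Let injl : {in l &, injective KeyHash}.
Proof. by move=> x y /l_sub xD /l_sub yD; exact: injKH. Qed.

Let vecE x : x \in l -> vec (KeyHash x) = transform p w rho x.
Proof. by move=> /l_sub; exact: vec_hash. Qed.

Let v_neq0 x : x \in D -> v x != 0 -> x \in l.
Proof.
move=> xD; rewrite mem_l xD; apply: contraNneq => wx.
by rewrite /v /transform wx mul0r.
Qed.

Let vec_supp i : (i \in map KeyHash l) = (vec i != 0).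
Proof.
apply/mapP/idP => [[x xl ->]|vi].
  by rewrite vecE// -normr_gt0; exact: (race_norm_gt0 p_gt0 w_neq0 racel).
have [/hasP[e eE /eqP ei]|ni] := boolP (has (fun e => KeyHash e.1 == i) E).
  have eD : e.1 \in D by exact: map_f.
  exists e.1 => //; apply: v_neq0 => //.
  by rewrite -vec_hash// ei.
move: vi; rewrite vec_data big_seq_cond big1 ?eqxx// => e /andP[eE ei].
by move/hasPn: ni => /(_ _ eE); rewrite ei.
Qed.

Lemma two_pass_correct :
  linf (fun i => estimate theta (pass1_data p KeyHash t1 rho) i - vec i) ^+ q <=
    (1 + M)^-1 / 3 ^+ q / k.+1%:R * lq_pow q (tail k.+1 vec) ->
  is_ppswor_sample p k E rho
    (two_pass p k (576 * k) KeyHash t1 t2 rho theta).1.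
Proof.
set err := linf _ => acc.
have M1 : 0 < 1 + M by rewrite ltr_wpDr.
have errE x : `|pass1_est p KeyHash t1 rho theta x - vec (KeyHash x)| <= err.
  exact: (le_bigmax _ (fun i => `|estimate theta (pass1_data p KeyHash t1 rho) i - vec i|)).
have err0 : 0 <= err by exact: bigmax_ge_id.
have hD : {in unzip1 (elements t2) &, injective (fun x => nat_of_ord (KeyHash x))}.
  by move=> x y xD yD /val_inj; exact: injKH.
have km : (k <= 576 * k)%N by rewrite leq_pmull.
(* With at most k nonzero frequencies the guarantee of the sketch has right-hand side 0, and the
   estimates are exact. *)
have [lk|kl] := leqP (size l) k.
  apply: (sample_exact hD km) => x xD.
  move: acc.
  rewrite (lq_pow_tail_support p_gt0 ul injl w_neq0 racel vecE vec_supp)//;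
    last exact: leqW.
  rewrite mulr0 => acc; have {acc} : err ^+ q == 0 by rewrite eq_le acc exprn_ge0.
  rewrite expf_eq0 q_gt0/= => /eqP e0.
  by have := errE x; rewrite e0 normr_le0 subr_eq0 vec_hash// => /eqP.
have [x0 _] : exists x0 : K, x0 \in l.
  by case: (l) kl => // x0 s _; exists x0; rewrite mem_head.
have k1l : (k.-1 < size l)%N by exact: leq_ltn_trans (leq_pred k) kl.
set vk := `|v (nth x0 l k.-1)|.
have vk0 : 0 < vk by apply: (race_norm_gt0 p_gt0 w_neq0 racel); rewrite mem_nth.
(* The tail beyond k + 1 is at most the tail beyond k, hence at most M k vk^q. The factors M / (1 +
   M) and k / (k + 1) are at most 1, and what remains is the q-th power of vk / 3: this is the
   reason for the 3^q in psi. *)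
have err_vk : err <= vk / 3.
  rewrite -(@ler_pXn2r _ q)// ?nnegrE ?divr_ge0 ?(ltW vk0)//.
  apply: (le_trans acc).
  have kl' : (0 < k < size l)%N by rewrite k_gt0.
  have h1 := lq_pow_tail_good p_gt0 ul injl w_neq0 racel vecE vec_supp x0 q_gt0
    kl' (goodl kl) boundM.
  have {h1}h1 := le_trans (lq_pow_tailS k vec q_gt0) h1.
  have c0 : 0 <= (1 + M)^-1 / 3 ^+ q / k.+1%:R :> R.
    by rewrite !divr_ge0// invr_ge0 ltW.
  apply: (le_trans (ler_wpM2l c0 h1)).
  rewrite -/v -/vk expr_div_n.
  have -> : (1 + M)^-1 / 3 ^+ q / k.+1%:R * (M * k%:R * vk ^+ q) =
     (M / (1 + M)) * (k%:R / k.+1%:R) * (vk ^+ q / 3 ^+ q) by ring.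
  rewrite ler_piMl ?divr_ge0 ?exprn_ge0 ?(ltW vk0)//.
  rewrite mulr_ile1 ?divr_ge0 ?(ltW M1)//.
    by rewrite ler_pdivrMr// mul1r lerDr.
  by rewrite ler_pdivrMr ?ltr0n// mul1r ler_nat.
have sorted_v i j : (i <= j < size l)%N -> `|v (nth x0 l j)| <= `|v (nth x0 l i)|.
  move=> /andP[]; rewrite leq_eqVlt => /orP[/eqP->//|ij jl].
  exact/ltW/(race_sorted p_gt0 w_neq0 racel).
apply: (sample_approx hD km (tau := vk) (L := take k l)).
- exact: take_uniq.
- by move=> x /mem_take; exact: l_sub.
- by rewrite size_takel// ltnW.
- move=> x xk; have xl := mem_take xk; rewrite -/(v x).
  rewrite -(nth_index x0 xl); apply: sorted_v; rewrite k1l andbT.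
  by move: xk; rewrite in_take// -{1}(prednK k_gt0) ltnS.
- move=> y yD yk; rewrite -/(v y).
  have [vy|vy] := eqVneq (v y) 0; first by rewrite vy normr0 ltW.
  have yl := v_neq0 yD vy.
  rewrite -[in leLHS](nth_index x0 yl); apply: sorted_v; rewrite index_mem yl andbT.
  by move: yk; rewrite in_take// -leqNgt; exact: leq_trans (leq_pred k).
- by move=> x xD; rewrite -/(v x) -vec_hash//; exact: le_trans (errE x) err_vk.
- apply: (@leq_trans (size (take (576 * k) l))); last by rewrite size_take_min geq_minl.
  apply: uniq_leq_size; first by rewrite filter_uniq// undup_uniq.
  move=> x; rewrite mem_filter mem_undup => /andP[vx xD].
  have xl : x \in l.
    apply: v_neq0 => //; rewrite -normr_gt0.
    by move: vx vk0; rewrite -/(v x); lra.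
  rewrite in_take//.
  exact: (race_good_count p_gt0 w_neq0 racel k_gt0 (goodl kl) p_le2 (ltnW kl) xl vx).
Qed.

End two_pass_correct.

Section measurable_bool_lists.
Context d (Z : measurableType d).

Lemma measurable_all (I : Type) (b : I -> Z -> bool) (s : seq I) :
  (forall i, measurable_fun [set: Z] (b i)) ->
  measurable_fun [set: Z] (fun z => all (b ^~ z) s).
Proof.
move=> mb; elim: s => [|i s IH] /=; first exact: measurable_cst.
exact: measurable_and.
Qed.

Lemma measurable_path (I : Type) (e : Z -> rel I) (x : I) (s : seq I) :
  (forall i j, measurable_fun [set: Z] (fun z => e z i j)) ->
  measurable_fun [set: Z] (fun z => path (e z) x s).
Proof.
move=> me; elim: s x => [|i s IH] x /=; first exact: measurable_cst.
exact: measurable_and.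
Qed.

Lemma measurable_set_bool (b : Z -> bool) : measurable_fun [set: Z] b ->
  measurable [set z | b z].
Proof.
by move=> /(_ measurableT [set true]); rewrite setTI; apply.
Qed.

Lemma measurable_bigmax (R : realType) (I : Type) (s : seq I) (f : I -> Z -> R) :
  (forall i, measurable_fun [set: Z] (f i)) ->
  measurable_fun [set: Z] (fun z => \big[Num.max/0]_(i <- s) f i z).
Proof.
move=> mf; elim: s => [|i s IH].
  by under eq_fun do rewrite big_nil; exact: measurable_cst.
by under eq_fun do rewrite big_cons; exact: measurable_maxr.
Qed.

End measurable_bool_lists.

(** * Measurability of the output and of the success event *)

Section measurable_two_pass.
Context {R : realType} {K : eqType}.

Definition is_topb (k : nat) (D : seq K) (v : K -> R) (s : seq K) : bool :=
  [&& uniq s, all (fun x => x \in D) s, size s == minn k (size (undup D)) &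
    all (fun x => all (fun y => (y \in s) || (`|v y| <= `|v x|)) D) s].

Lemma is_topP k D v s : is_top k D v s <-> is_topb k D v s.
Proof.
split=> [[us sD ss top]|/and4P[us /allP sD /eqP ss /allP top]].
  apply/and4P; split=> //; [exact/allP|exact/eqP|].
  apply/allP => x xs; apply/allP => y yD.
  by have [//|ys] := boolP (y \in s); exact: top.
split=> // x y xs yD /negbTE ys.
by have /allP/(_ _ yD) := top x xs; rewrite ys.
Qed.

Section top.
Context d (Z : measurableType d) (k : nat) (D : seq K) (v : Z -> K -> R).
Hypothesis mv : forall x, measurable_fun [set: Z] (v ^~ x).

Let measurable_norm_le x y : measurable_fun [set: Z] (fun z => `|v z y| <= `|v z x|).
Proof. by apply: measurable_fun_ler; exact: measurableT_comp. Qed.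

Lemma measurable_is_top s : measurable [set z | is_top k D (v z) s].
Proof.
rewrite (_ : mkset _ = [set z | is_topb k D (v z) s]); last first.
  by apply/funext => z; apply/propext; exact: is_topP.
apply: measurable_set_bool; rewrite /is_topb.
do 3 apply: measurable_and => //.
apply: measurable_all => x; apply: measurable_all => y.
exact: measurable_or.
Qed.

Lemma measurable_is_top_tuple s : measurable [set z | is_top_tuple k D (v z) s].
Proof.
apply: measurableI; first exact: measurable_is_top.
apply: measurable_set_bool; case: s => [|x s]; first exact: measurable_cst.
by apply: measurable_path => i j; exact: measurable_norm_le.
Qed.

End top.

Lemma measurable_is_ppswor_sample d (Z : measurableType d) p k E (rho : Z -> K -> R) S :
  (forall x, measurable_fun [set: Z] (rho ^~ x)) ->
  measurable [set z | is_ppswor_sample p k E (rho z) S].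
Proof.
move=> mrho; apply: measurableI.
  apply: (@measurable_is_top _ _ k (unzip1 E) (fun z => transform p (freq E) (rho z))) => x.
  exact: (@measurable_transform _ _ _ _ p (freq E) (fun x z => rho z x)).
exact: decided_measurable (decided_cst _).
Qed.

Section run.
Context d (Z : measurableType d) (pr : Z -> K -> R) (h : K -> nat) (m : nat).
Hypothesis mpr : forall x, measurable_fun [set: Z] (pr ^~ x).

Let decided_top_prune s : decided (fun z => top_prune (pr z) h m s).
Proof.
apply: (decided_comp (take m)); apply: decided_sort => a b; apply: decided_bool.
apply: measurable_or; first exact: measurable_fun_ltr.
by apply: measurable_and => //; exact: measurable_fun_eqr.
Qed.

Lemma decided_run_top (t : assembly (K * R)) :
  decided (fun z => run (top_sketch (pr z) h m) t).
Proof.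
elim: t => [|t IH e|t1 IH1 t2 IH2] /=; first exact: decided_cst.
  exact: (decided_bind (g := fun s z => top_prune (pr z) h m (top_update s e)) IH).
apply: (decided_bind (g := fun s z => top_prune (pr z) h m
  (foldl (@top_update R K) s (run (top_sketch (pr z) h m) t2))) IH1) => s.
exact: (decided_bind (g := fun s' z => top_prune (pr z) h m
  (foldl (@top_update R K) s s')) IH2).
Qed.

End run.

Lemma amap_comp (E F G : Type) (g : F -> G) (f : E -> F) (t : assembly E) :
  amap g (amap f t) = amap (g \o f) t.
Proof. by elim: t => //= [t -> e|t1 -> t2 ->]. Qed.

Context {n : nat} (p : R) (k m : nat) (KeyHash : K -> 'I_n) (A : est_sketch R n).
Context d (T : measurableType d) (P : probability T R) (r : K -> {RV P >-> R}).
Variables (t1 t2 : assembly (K * R)).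
Hypothesis mA : measurable_estimates A.

Let mval (e : K * R) : measurable_fun [set: T] (fun omega => e.2 / r e.1 omega `^ p^-1).
Proof. exact: (@measurable_transform _ _ _ _ p (fun=> e.2) (fun x => r x)). Qed.

Let val_mixin e := isMeasurableFun.Build _ _ _ _ _ (mval e).
Let val (e : K * R) : {mfun T >-> R} :=
  HB.pack (fun omega => e.2 / r e.1 omega `^ p^-1) (val_mixin e).

(** The transformed element values are packed as measurable functions on [T], so that pass I is an
    instance of the random datasets in [measurable_estimates]. *)
Lemma measurable_estimate_pass1 i : measurable_fun [set: T * seed A]
  (fun z => estimate z.2 (pass1_data p KeyHash t1 (r ^~ z.1)) i).
Proof.
have := @mA _ T (amap (fun e => (KeyHash e.1, val e)) t1) i.
by under eq_fun do rewrite amap_comp.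
Qed.

Lemma measurable_pass1_est x : measurable_fun [set: T * seed A]
  (fun z => pass1_est p KeyHash t1 (r ^~ z.1) z.2 x).
Proof. exact: measurable_estimate_pass1. Qed.

Let measurable_rfst x : measurable_fun [set: T * seed A] (fun z => r x z.1).
Proof. exact: measurableT_comp. Qed.

Lemma decided_two_pass : decided (fun z : T * seed A =>
  (two_pass p k m KeyHash t1 t2 (r ^~ z.1) z.2).1).
Proof.
have dp : decided (fun z : T * seed A => pass2 p m KeyHash t1 t2 (r ^~ z.1) z.2).
  apply: (@decided_run_top _ _ (fun z x => `|pass1_est p KeyHash t1 (r ^~ z.1) z.2 x|)) => x.
  by apply: measurableT_comp => //; exact: measurable_pass1_est.
pose mag (z : T * seed A) (e : K * R) := `|e.2 / r e.1 z.1 `^ p^-1|.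
apply: (decided_bind
  (g := fun s z => take k (sort (fun a b => mag z b <= mag z a) s)) dp) => s.
apply: (decided_comp (take k)); apply: decided_sort => a b; apply: decided_bool.
apply: measurable_fun_ler; apply: measurableT_comp => //.
  exact: (@measurable_transform _ _ _ _ p (fun=> b.2) (fun x z => r x z.1)).
exact: (@measurable_transform _ _ _ _ p (fun=> a.2) (fun x z => r x z.1)).
Qed.

Lemma measurable_returned E : measurable [set z : T * seed A |
  is_ppswor_sample p k E (r ^~ z.1) (two_pass p k m KeyHash t1 t2 (r ^~ z.1) z.2).1].
Proof.
apply: (decided_two_pass (Q := fun S => [set z | is_ppswor_sample p k E (r ^~ z.1) S])) => S.
exact: measurable_is_ppswor_sample.
Qed.

Lemma measurable_accurate omega q c (u : 'I_n -> R) : measurable [set theta : seed A |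
  linf (fun i => estimate theta (pass1_data p KeyHash t1 (r ^~ omega)) i - u i) ^+ q <= c].
Proof.
apply: measurable_set_bool; apply: measurable_fun_ler => //.
apply: measurable_funX; rewrite /linf.
apply: measurable_bigmax => i; apply: measurableT_comp => //.
apply: measurable_funB => //.
exact: (measurableT_comp (measurable_estimate_pass1 i) (pair1_measurable omega)).
Qed.

End measurable_two_pass.

(** * Success probability and sketch sizes *)

Section success_probability.
Context {R : realType} {n : nat} (p : R) (positive : bool) (q k : nat) (M delta : R).
Context (A : est_sketch R n).
Hypotheses (p_gt0 : 0 < p) (p_le2 : p <= 2) (q_gt0 : (0 < q)%N) (k_gt0 : (0 < k)%N)
  (M_ge0 : 0 <= M) (delta_le1 : delta <= 1)
  (boundM : forall m, (k <= m <= n)%N -> 64 `^ (q%:R / p) *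
    \sum_(k <= j < m) (k%:R / j.+1%:R) `^ (q%:R / p) <= M * k%:R)
  (rHH : is_rHH positive q k.+1 ((1 + M)^-1 / 3 ^+ q) delta A).
Context d (T : measurableType d) (P : probability T R) (K : eqType)
  (r : K -> {RV P >-> R}) (KeyHash : K -> 'I_n) (E : seq (K * R))
  (t1 t2 : assembly (K * R)).
Hypotheses (iid : iid_exp1 r) (injKH : {in unzip1 E &, injective KeyHash})
  (t1E : perm_eq (elements t1) E) (t2E : perm_eq (elements t2) E)
  (posE : positive -> forall e, e \in E -> 0 < e.2).

Let w := freq E.
Let lam := exp_rate p w.
Let N := [seq x <- undup (unzip1 E) | w x != 0].
Let mu : set (T * seed A) -> \bar R := (P \x seedP A)%E.
Let returned : set (T * seed A) := [set z | is_ppswor_sample p k E (r ^~ z.1)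
  (two_pass p k (576 * k) KeyHash t1 t2 (r ^~ z.1) z.2).1].

Let uN : uniq N. Proof. by rewrite filter_uniq// undup_uniq. Qed.

Let w_neq0 l x : l \in permutations N -> x \in l -> w x != 0.
Proof.
by rewrite mem_permutations => lN; rewrite (perm_mem lN) mem_filter => /andP[].
Qed.

Let lam_gt0 x : x \in N -> 0 < lam x.
Proof. by rewrite mem_filter => /andP[wx _]; exact: exp_rate_gt0. Qed.

(* The keys of frequency 0 come last: their index is [size l]. *)
Lemma race_event_le l t x y : l \in permutations N -> race_event r lam l t ->
  x \in unzip1 E -> y \in unzip1 E ->
  (`|transform p w (r ^~ t) y| <= `|transform p w (r ^~ t) x|) =
  (index x l <= index y l)%N.
Proof.
move=> lN lt xE yE; set v := transform _ _ _.
have wl z : z \in l -> w z != 0 by exact: w_neq0.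
have v0 z : z \in unzip1 E -> z \notin l -> v z = 0.
  move: lN; rewrite mem_permutations => lN zE.
  rewrite (perm_mem lN) mem_filter mem_undup zE andbT negbK.
  by move=> /eqP wz; rewrite /v /transform wz mul0r.
have vlt a b : (index a l < index b l)%N -> b \in l -> `|v b| < `|v a|.
  move=> ab bl; have al : a \in l.
    by rewrite -index_mem (ltn_trans ab)// index_mem.
  have := @race_sorted _ _ p w p_gt0 (r ^~ t) l wl lt a (index a l) (index b l) ab.
  by rewrite !nth_index// index_mem; apply.
have [xl|xl] := boolP (x \in l); last first.
  rewrite (v0 _ xE xl) normr0 normr_le0 (memNindex xl).
  have [yl|yl] := boolP (y \in l).
    rewrite leqNgt index_mem yl/=; apply/negbTE; rewrite -normr_gt0.
    exact: (race_norm_gt0 p_gt0 wl lt).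
  by rewrite (v0 _ yE yl) eqxx (memNindex yl) leqnn.
have [yl|yl] := boolP (y \in l); last first.
  by rewrite (v0 _ yE yl) normr0 normr_ge0 (memNindex yl) index_size.
have [h|h|h] := ltngtP (index x l) (index y l).
- exact/ltW/vlt.
- by apply/negbTE; rewrite -ltNge; exact: vlt.
- by rewrite -(nth_index x xl) h nth_index// lexx.
Qed.

(** Only orders of more than k keys count: for shorter ones the sketch is exact and no concentration
    is required. *)
Let bad : set T := \big[setU/set0]_(l <- permutations N | (k < size l)%N)
  [set t | race lam (r ^~ t) (rev l) && ~~ race_good lam k (r ^~ t) (rev l)].

Let measurable_bad : measurable bad.
Proof.
apply: bigsetU_measurable => l _; apply: measurable_race_setU.
by apply: measurable_neg; exact: measurable_race_good.
Qed.

(** With the r_x fixed, the data of pass I are deterministic, so the sketch guarantee applies to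
    them; every accurate seed then leads to a correct sample. *)
Let returned_accurate l t : l \in permutations N -> race_event r lam l t -> ~ bad t ->
  ((1 - delta)%:E <= seedP A (xsection returned t))%E.
Proof.
move=> lN lt nbad; have [mA acc] := rHH.
have lN' : perm_eq l N by move: lN; rewrite mem_permutations.
apply: le_trans (acc (pass1_data p KeyHash t1 (r ^~ t)) _) _.
  (* Positive element values stay positive: their keys have nonzero frequency, hence take part in
     the race, and so r_x > 0. *)
  move=> pos e; rewrite elements_amap => /mapP[e']; rewrite (perm_mem t1E) => eE -> /=.
  have e0 := posE pos eE; rewrite divr_gt0// powR_gt0//.
  have el : e'.1 \in l.
    rewrite (perm_mem lN') mem_filter mem_undup map_f// andbT gt_eqF//.
    rewrite /w /freq (big_rem e')//= eqxx ltr_wpDr// big_seq_cond sumr_ge0// => f /andP[fE _].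
    by apply/ltW/(posE pos); exact: mem_rem fE.
  by apply: (race_rv_gt0 _ lt el) => x; exact: w_neq0.
cbv zeta; apply: le_measure; rewrite ?inE.
- exact: measurable_accurate.
- by apply: measurable_xsection; exact: measurable_returned.
move=> theta /= hacc; rewrite /xsection/= inE /returned/=.
apply: is_ppswor_sample_perm t2E _.
have fE : freq (elements t2) = freq E := perm_freq t2E.
have mE : unzip1 (elements t2) =i unzip1 E by apply/perm_mem/perm_map.
apply: (two_pass_correct (q := q) (M := M) (l := l)) => //.
- by rewrite (perm_trans t1E)// perm_sym.
- by move=> x y; rewrite !mE; exact: injKH.
- apply: (perm_trans lN'); apply: uniq_perm => //; first by rewrite filter_uniq// undup_uniq.
  by move=> x; rewrite !mem_filter !mem_undup mE fE.
- by rewrite fE.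
- move=> kl; rewrite fE; apply/negPn/negP => ng; apply: nbad.
  apply/in_bigsetU; exists l; rewrite ?lN//=.
  by apply/andP; split.
Qed.

(** The whole space as [Q] gives the unconditional bound, the event of a given top-k tuple the
    conditional one. Over each point of [Q] that lies in a race and is not bad, the section of the
    success event has mass at least 1 - delta; integrating over these points gives the product. *)
Lemma two_pass_success (Q : set T) : measurable Q ->
  (forall l t t', l \in permutations N -> race_event r lam l t ->
    race_event r lam l t' -> Q t -> Q t') ->
  (((1 - delta) * (1 - 2 * expR (- k%:R)))%:E * P Q <=
   mu (returned `&` fst @^-1` Q))%E.
Proof.
move=> mQ detQ; have [mA acc] := rHH.
set U := \big[setU/set0]_(l <- permutations N) race_event r lam l.
have mU : measurable U.
  by apply: bigsetU_measurable => l _; exact: measurable_race_event.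
have d0 : 0 <= 1 - delta by rewrite subr_ge0.
pose G := Q `&` U `\` bad.
have mG : measurable G by apply: measurableD => //; exact: measurableI.
have key := @race_cond_bound _ _ _ P _ r lam N iid uN lam_gt0 k Q bad mQ measurable_bad detQ.
have {}key : (P (Q `&` bad) <= (2 * expR (- k%:R))%:E * P Q)%E.
  apply: key => l t lN lt /in_bigsetU[l' /andP[l'N kl'] /andP[lt' ng]].
  have ll' : l = l' by exact: race_event_inj lN l'N lt lt'.
  by rewrite ll'; split=> //; exact: ltnW.
have PG : ((1 - 2 * expR (- k%:R))%:E * P Q <= P G)%E.
  have h : (P Q <= P (Q `&` bad) + P G)%E.
    have mQB : measurable (Q `&` bad) by exact: measurableI.
    have mQU : measurable (Q `&` ~` U) by apply: measurableI => //; exact: measurableC.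
    have z : (P (Q `&` ~` U) <= 0)%E.
      rewrite -(race_events_setT iid uN lam_gt0); apply: le_measure; rewrite ?inE//.
      exact: measurableC.
    have mGU : measurable (G `|` Q `&` ~` U) by exact: measurableU.
    apply: (@le_trans _ _ (P ((Q `&` bad) `|` (G `|` (Q `&` ~` U))))).
      apply: le_measure; rewrite ?inE//; first exact: measurableU.
      move=> t Qt; have [bt|nbt] := pselect (bad t); first by left.
      by right; have [Ut|nUt] := pselect (U t); [left|right].
    apply: le_trans (measureU2 _ mQB mGU) _; rewrite leeD2l//.
    apply: le_trans (measureU2 _ mG mQU) _.
    by rewrite -[leRHS]adde0; exact: leeD.
  have fQ := fin_num_measure P _ mQ; have fG := fin_num_measure P _ mG.
  have fB := fin_num_measure P _ (measurableI _ _ mQ measurable_bad).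
  move: h key; rewrite -(fineK fQ) -(fineK fG) -(fineK fB) -EFinD -!EFinM !lee_fin.
  lra.
apply: (@le_trans _ _ ((1 - delta)%:E * P G)%E).
  by rewrite EFinM -muleA lee_wpmul2l.
have mret : measurable returned by exact: measurable_returned.
have mfQ : measurable (fst @^-1` Q : set (T * seed A)).
  by rewrite -[X in measurable X]setTI; exact: measurable_fst.
have mrQ : measurable (returned `&` fst @^-1` Q) by exact: measurableI.
have -> : ((1 - delta)%:E * P G = \int[P]_t ((1 - delta)%:E * (\1_G t)%:E))%E.
  rewrite ge0_integralZl//; first by rewrite integral_indic// setIT.
    exact/measurable_EFinP/measurable_indic.
rewrite /mu /product_measure1.
apply: ge0_le_integral => //=.
- by move=> t _; rewrite mule_ge0 ?lee_fin.
- by apply: measurable_funeM; exact/measurable_EFinP/measurable_indic.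
- exact: measurable_fun_xsection.
move=> t _; rewrite indicE; have [/set_mem[[Qt Ut] nbad]|_] := boolP (t \in G); last first.
  by rewrite mule0.
rewrite mule1.
have /in_bigsetU[l /andP[lN _] lt] := Ut.
apply: (le_trans (returned_accurate lN lt nbad)).
apply: le_measure; rewrite ?inE.
- exact: measurable_xsection.
- exact: measurable_xsection.
- by move=> theta; rewrite /xsection/= !inE => ret; split.
Qed.

End success_probability.

Section guarantee.
Context {R : realType} {n : nat} (p : R) (positive : bool) (q k : nat) (M delta : R).
Context (A : est_sketch R n).
Hypotheses (p_gt0 : 0 < p) (p_le2 : p <= 2) (q_gt0 : (0 < q)%N) (k_gt0 : (0 < k)%N)
  (M_ge0 : 0 <= M) (delta_le1 : delta <= 1)
  (boundM : forall m, (k <= m <= n)%N -> 64 `^ (q%:R / p) *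
    \sum_(k <= j < m) (k%:R / j.+1%:R) `^ (q%:R / p) <= M * k%:R)
  (rHH : is_rHH positive q k.+1 ((1 + M)^-1 / 3 ^+ q) delta A).

Lemma two_pass_guarantee (words keys success : R) :
  (forall (theta : seed A) t, (es_words theta t)%:R + (576 * k)%:R <= words) ->
  (576 * k)%:R <= keys ->
  success <= (1 - delta) * (1 - 2 * expR (- k%:R)) ->
  two_pass_returns_ppswor p positive k (576 * k) A words keys success.
Proof.
move=> hwords hkeys hsucc d T P K r KeyHash E t1 t2 iid injKH t1E t2E posE.
move=> r_ mu returned top_is.
have spass2 omega theta : (size (pass2 (A := A) p (576 * k) KeyHash t1 t2 (r_ omega) theta)
    <= 576 * k)%N by exact: size_run_top_sketch.
have [mA _] := rHH.
have mret : measurable returned by exact: measurable_returned.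
have main := two_pass_success p_gt0 p_le2 q_gt0 k_gt0 M_ge0 delta_le1 boundM rHH
  iid injKH t1E t2E posE.
have muT (Q : set T) : measurable Q -> mu (fst @^-1` Q) = P Q.
  move=> mQ; have -> : fst @^-1` Q = Q `*` [set: seed A] by rewrite setXT.
  by rewrite /mu product_measure1E// [X in (_ * X)%E](probability_setT (seedP A)) mule1.
split.
- move=> omega theta; apply: le_trans (hwords theta (pass1_data p KeyHash t1 (r_ omega))).
  by rewrite /two_pass_words natrD lerD2l ler_nat; exact: spass2.
- by move=> omega theta; apply: le_trans hkeys; rewrite ler_nat; exact: spass2.
- apply: (@le_trans _ _ (((1 - delta) * (1 - 2 * expR (- k%:R)))%:E * P [set: T])%E).
    by rewrite probability_setT mule1 lee_fin.
  have := main setT measurableT (fun _ _ _ _ _ _ _ => I).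
  by rewrite preimage_setT setIT.
move=> s tops0.
pose Q := [set t | is_top_tuple k (unzip1 E) (transform p (freq E) (r ^~ t)) s].
have mQ : measurable Q.
  apply: (@measurable_is_top_tuple _ _ _ _ k (unzip1 E)
    (fun t => transform p (freq E) (r ^~ t))) => x.
  exact: (@measurable_transform _ _ _ _ p (freq E) (fun x t => r x t)).
have topE : top_is s = fst @^-1` Q by [].
(* Two outcomes of the same race compare any two keys of the dataset alike, those of frequency 0
   included, so they have the same top tuples. *)
have detQ l t t' : l \in permutations [seq x <- undup (unzip1 E) | freq E x != 0] ->
    race_event r (exp_rate p (freq E)) l t -> race_event r (exp_rate p (freq E)) l t' ->
    Q t -> Q t'.
  move=> lN lt lt' [[us sE ss top] sorted_s].
  have cmpE x y : x \in unzip1 E -> y \in unzip1 E ->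
    (`|transform p (freq E) (r ^~ t') y| <= `|transform p (freq E) (r ^~ t') x|) =
    (`|transform p (freq E) (r ^~ t) y| <= `|transform p (freq E) (r ^~ t) x|).
    by move=> xE yE; rewrite (race_event_le p_gt0 lN lt')// (race_event_le p_gt0 lN lt).
  split; first split=> //.
    by move=> x y xs yE ys; rewrite cmpE//; [exact: top|exact: sE].
  have cmp_in : {in unzip1 E &, (fun x y => `|transform p (freq E) (r ^~ t') y| <=
      `|transform p (freq E) (r ^~ t') x|) =2 (fun x y =>
      `|transform p (freq E) (r ^~ t) y| <= `|transform p (freq E) (r ^~ t) x|)}.
    by move=> x y; exact: cmpE.
  by rewrite (eq_in_sorted cmp_in)//; exact/allP.
have PQ0 : 0 < fine (P Q).
  have fQ := fin_num_measure P _ mQ.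
  have : P Q != 0%E by rewrite -muT// -topE.
  by rewrite -lte_fin fineK// lt_neqAle eq_sym => -> /=.
have := main Q mQ detQ; rewrite -/r_ -/returned -/mu => h.
rewrite /cprob topE muT// ler_pdivlMr//.
apply: (@le_trans _ _ ((1 - delta) * (1 - 2 * expR (- k%:R)) * fine (P Q))).
  by rewrite ler_wpM2r// ltW.
have mrQ : measurable (returned `&` fst @^-1` Q).
  apply: measurableI => //.
  by rewrite -[X in measurable X]setTI; exact: measurable_fst.
have frQ : mu (returned `&` fst @^-1` Q) \is a fin_num.
  rewrite ge0_fin_numE; last by exact: measure_ge0.
  apply: (@le_lt_trans _ _ (mu (fst @^-1` Q))); last by rewrite muT// ltey_eq fin_num_measure.
  apply: le_measure; rewrite ?inE//.
  by rewrite -[X in measurable X]setTI; exact: measurable_fst.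
by rewrite -lee_fin EFinM !fineK// fin_num_measure.
Qed.

End guarantee.

(** * Constants in the sketch sizes *)

Section sketch_sizes.
Context {R : realType}.
Variables (p : R) (M : nat -> R) (size : nat -> nat -> R) (C1 : R).
Hypotheses (p_gt0 : 0 < p) (p_le2 : p <= 2)
  (M_ge0 : forall n, (1 < n)%N -> 0 <= M n) (C1_ge0 : 0 <= C1)
  (size_ge0 : forall n k, (1 < n)%N -> 0 <= size n k)
  (k_le : forall n k, (1 < n)%N -> (0 < k)%N -> k%:R <= C1 * size n k).

Let boundM (q : nat) := forall n k m, (1 < n)%N -> (0 < k)%N -> (k <= m <= n)%N ->
  64 `^ (q%:R / p) * \sum_(k <= j < m) (k%:R / j.+1%:R) `^ (q%:R / p) <= M n * k%:R.

Let L (n k : nat) : R := (1 + M n)^-1.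

Lemma valid_psi_lower_bound q : (0 < q)%N -> boundM q -> valid_psi p q L.
Proof.
move=> q0 bM n k n1 k0; have M1 : 1 <= 1 + M n by rewrite lerDl M_ge0.
have M0 : 0 < 1 + M n by exact: lt_le_trans M1.
split; first by rewrite invr_gt0.
  by apply: Psi_lower_bound => //; [exact: M_ge0|move=> m; exact: bM].
rewrite /L -invfM invf_le1 ?mulr_gt0 ?exprn_gt0//.
by rewrite mulr_ege1// exprn_ege1// ler1n.
Qed.

Lemma two_pass_CountSketch_size : boundM 2 ->
  (forall n k, (1 < n)%N -> (0 < k)%N -> k%:R * (1 + M n) * ln n%:R <= C1 * size n k) ->
  two_pass_CountSketch p size.
Proof.
move=> bM sizeM; exists 576%N, L; split; first exact: valid_psi_lower_bound.
(* Here 18 = 2 * 3^2, from k + 1 <= 2 k and the 3^q in psi, and 1 + c comes from ln (n / n^(-c)).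
   The term 576 C1 pays for the frequencies stored in pass II, the last 576 for the key strings. The
   absolute value is there because [C0] has no prescribed sign. *)
move=> c C0 c0; exists (`|C0| * (18 * (1 + c)) * C1 + 576 * C1 + 576).
move=> n k A n1 k0 [rHH words].
have n1R : 1 < n%:R :> R by rewrite ltr1n.
have n0R : 0 < n%:R :> R by exact: lt_trans n1R.
have nc0 : 0 < n%:R `^ (- c) :> R by exact: powR_gt0.
have nc1 : n%:R `^ (- c) <= 1 :> R.
  rewrite powRN invf_le1 ?powR_gt0//.
  have : n%:R `^ 0 <= n%:R `^ c :> R by apply: ler_powR; exact: ltW.
  by rewrite powRr0.
have sz := size_ge0 k n1; have ks := k_le n1 k0; have sM := sizeM n k n1 k0.
have kR : 1 <= k%:R :> R by rewrite ler1n.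
apply: (two_pass_guarantee p_gt0 p_le2 _ k0 (M_ge0 n1) nc1 _ rHH) => //.
- by move=> m; exact: bM.
- move=> theta t; apply: (le_trans (lerD (words theta t) (lexx _))).
  rewrite natrM.
  have -> : ln (n%:R / n%:R `^ (- c)) = (1 + c) * ln n%:R.
    by rewrite ln_div ?posrE// ln_powR; ring.
  have ln0 : 0 <= ln n%:R :> R by rewrite ln_ge0// ltW.
  have Mn := M_ge0 n1.
  have -> : k.+1%:R / (L n k / 3 ^+ 2) = 9 * (k.+1%:R * (1 + M n)).
    by rewrite /L; field; rewrite gt_eqF// ltr_wpDr.
  have kS : k.+1%:R <= 2 * k%:R :> R by rewrite -natrM ler_nat mul2n -addnn -addn1 leq_add2l.
  have h : 9 * (k.+1%:R * (1 + M n)) * ((1 + c) * ln n%:R) <= 18 * (1 + c) * (C1 * size n k).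
    apply: (@le_trans _ _ (18 * (1 + c) * (k%:R * (1 + M n) * ln n%:R))).
      have e0 : 0 <= (1 + M n) * ((1 + c) * ln n%:R).
        by rewrite !mulr_ge0// addr_ge0// ltW.
      have := ler_wpM2r e0 kS; lra.
    by rewrite ler_wpM2l// mulr_ge0// addr_ge0// ltW.
  have h0 : 0 <= 9 * (k.+1%:R * (1 + M n)) * ((1 + c) * ln n%:R).
    by rewrite !mulr_ge0// addr_ge0// ltW.
  have h1 : C0 * (9 * (k.+1%:R * (1 + M n)) * ((1 + c) * ln n%:R)) <=
      `|C0| * (18 * (1 + c) * (C1 * size n k)).
    apply: (@le_trans _ _ (`|C0| * (9 * (k.+1%:R * (1 + M n)) * ((1 + c) * ln n%:R)))).
      by rewrite ler_wpM2r// ler_norm.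
    by rewrite ler_wpM2l.
  lra.
- have a0 : 0 <= `|C0| * (18 * (1 + c)) * C1.
    by rewrite !mulr_ge0// addr_ge0// ltW.
  have b0 : 0 <= 576%:R * C1 by rewrite mulr_ge0 ?ler0n.
  by rewrite natrM; move: (576%:R : R) b0 => b b0; rewrite ler_wpM2r//; lra.
- rewrite ler_wpM2l ?subr_ge0// lerD2l lerN2 ler_wpM2r ?expR_ge0// ler_nat//.
Qed.

Lemma two_pass_Counters_size : boundM 1 ->
  (forall n k, (1 < n)%N -> (0 < k)%N -> k%:R * (1 + M n) <= C1 * size n k) ->
  two_pass_Counters p size.
Proof.
move=> bM sizeM; exists 576%N, L; split; first exact: valid_psi_lower_bound.
(* As for CountSketch, with 6 = 2 * 3 and no logarithm, since Counters is deterministic in its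
   guarantee (delta = 0). *)
move=> C0; exists (`|C0| * 6 * C1 + 576 * C1 + 576).
move=> n k A n1 k0 [rHH words].
have sz := size_ge0 k n1; have ks := k_le n1 k0; have sM := sizeM n k n1 k0.
have kR : 1 <= k%:R :> R by rewrite ler1n.
apply: (two_pass_guarantee p_gt0 p_le2 _ k0 (M_ge0 n1) ler01 _ rHH) => //.
- by move=> m; exact: bM.
- move=> theta t; apply: (le_trans (lerD (words theta t) (lexx _))).
  rewrite natrM.
  have Mn := M_ge0 n1.
  have -> : k.+1%:R / (L n k / 3 ^+ 1) = 3 * (k.+1%:R * (1 + M n)).
    by rewrite /L; field; rewrite gt_eqF// ltr_wpDr.
  have kS : k.+1%:R <= 2 * k%:R :> R by rewrite -natrM ler_nat mul2n -addnn -addn1 leq_add2l.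
  have h : 3 * (k.+1%:R * (1 + M n)) <= 6 * (C1 * size n k).
    have e0 : 0 <= 1 + M n by rewrite addr_ge0.
    have := ler_wpM2r e0 kS; lra.
  have h0 : 0 <= 3 * (k.+1%:R * (1 + M n)) by rewrite !mulr_ge0// addr_ge0.
  have h1 : C0 * (3 * (k.+1%:R * (1 + M n))) <= `|C0| * (6 * (C1 * size n k)).
    apply: (@le_trans _ _ (`|C0| * (3 * (k.+1%:R * (1 + M n))))).
      by rewrite ler_wpM2r// ler_norm.
    by rewrite ler_wpM2l.
  lra.
- have a0 : 0 <= `|C0| * 6 * C1 by rewrite !mulr_ge0.
  have b0 : 0 <= 576%:R * C1 by rewrite mulr_ge0 ?ler0n.
  by rewrite natrM; move: (576%:R : R) b0 => b b0; rewrite ler_wpM2r//; lra.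
- by rewrite subr0 mul1r lerD2l lerN2 ler_wpM2r ?expR_ge0// ler_nat.
Qed.

End sketch_sizes.

Theorem theorem4p1 (R : realType) (p : R) (p_gt0 : 0 < p) (p_le2 : p <= 2) :
  [/\ p < 2 -> two_pass_CountSketch p (fun n k => k%:R * ln n%:R),
      p = 2 -> two_pass_CountSketch p (fun n k => k%:R * ln n%:R ^+ 2),
      p < 1 -> two_pass_Counters p (fun n k => k%:R) &
      p = 1 -> two_pass_Counters p (fun n k => k%:R * ln n%:R)].
Proof.
(* From 1/2 <= ln 2; this lets constants be absorbed into ln n for every n >= 2. *)
have ln2 n : (1 < n)%N -> 1 <= 2 * ln n%:R :> R.
  move=> n1; have := @ln_natS_ge R 1 isT; rewrite ln1 subr0 => h.
  have : ln 2 <= ln n%:R :> R by rewrite ler_ln ?posrE ?ltr0n ?ler_nat// ltnW.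
  lra.
have bound_gt (q : nat) : p < q%:R -> forall n k m, (1 < n)%N -> (0 < k)%N ->
    (k <= m <= n)%N ->
    64 `^ (q%:R / p) * \sum_(k <= j < m) (k%:R / j.+1%:R) `^ (q%:R / p) <=
    64 `^ (q%:R / p) / (q%:R / p - 1) * k%:R.
  move=> pq n k m n1 k0 /andP[km _].
  rewrite -[leRHS]mulrA ler_wpM2l ?powR_ge0// [leRHS]mulrC.
  by apply: sum_powR_le; rewrite ?k0// ltr_pdivlMr// mul1r.
have M_gt0 (q : nat) : p < q%:R -> 0 <= 64 `^ (q%:R / p) / (q%:R / p - 1) :> R.
  by move=> pq; rewrite divr_ge0 ?powR_ge0// subr_ge0 ler_pdivlMr// mul1r ltW.
have bound_eq (q : nat) : p = q%:R -> forall n k m, (1 < n)%N -> (0 < k)%N ->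
    (k <= m <= n)%N ->
    64 `^ (q%:R / p) * \sum_(k <= j < m) (k%:R / j.+1%:R) `^ (q%:R / p) <=
    64 * ln n%:R * k%:R.
  move=> pq n k m n1 k0 /andP[km mn].
  rewrite -pq divff ?gt_eqF// powRr1// -[leRHS]mulrA ler_wpM2l//.
  have hs : \sum_(k <= j < m) (k%:R / j.+1%:R) `^ 1 <= k%:R * ln m%:R :> R.
    under eq_bigr do rewrite powRr1 ?divr_ge0//.
    by apply: sum_harmonic_le; rewrite k0.
  apply: (le_trans hs); rewrite mulrC ler_wpM2r// ler_ln ?posrE ?ltr0n ?ler_nat//.
    exact: leq_trans k0 km.
  exact: ltnW.
split=> hp.
- pose M : R := 64 `^ (2%:R / p) / (2%:R / p - 1).
  have M0 : 0 <= M by exact: M_gt0.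
  apply: (@two_pass_CountSketch_size _ p (fun=> M) _ (3 + M)) => //.
  + by rewrite addr_ge0.
  + by move=> n k /ln2 h; rewrite mulr_ge0//; lra.
  + move=> n k /ln2 h _; have := ler_wpM2l (ler0n R k) h.
    have l0 : 0 <= ln n%:R :> R by lra.
    have kl0 := mulr_ge0 (ler0n R k) l0.
    have := mulr_ge0 M0 kl0; move: (M) => M'; lra.
  + exact: bound_gt.
  + move=> n k /ln2 h _; have l0 : 0 <= ln n%:R :> R by lra.
    have := mulr_ge0 (ler0n R k) l0; move: (M) => M'; lra.
- pose M n : R := 64 * ln n%:R.
  have M0 n : (1 < n)%N -> 0 <= M n by move=> /ln2 h; rewrite mulr_ge0//; lra.
  (* The 1 in 1 + 64 ln n is at most 2 ln n, so 66 is enough for the words of the sketch. *)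
  apply: (@two_pass_CountSketch_size _ p M _ 70) => //.
  + by move=> n k /ln2 h; rewrite mulr_ge0// exprn_ge0//; lra.
  + move=> n k /ln2 h _; have h2 : 1 <= 4 * ln n%:R ^+ 2 :> R by nra.
    have := ler_wpM2l (ler0n R k) h2; have := ler0n R k; nra.
  + exact: bound_eq.
  + move=> n k /ln2 h _; have h2 : ln n%:R <= 2 * ln n%:R ^+ 2 :> R by nra.
    have := ler_wpM2l (ler0n R k) h2; rewrite /M.
    have : 0 <= k%:R * ln n%:R ^+ 2 :> R by rewrite mulr_ge0// exprn_ge0//; lra.
    lra.
- pose M : R := 64 `^ (1%:R / p) / (1%:R / p - 1).
  have M0 : 0 <= M by exact: M_gt0.
  apply: (@two_pass_Counters_size _ p (fun=> M) _ (1 + M)) => //.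
  + by rewrite addr_ge0.
  + by move=> n k _ _; rewrite mulrDl mul1r lerDl mulr_ge0.
  + exact: bound_gt.
  + by move=> n k _ _; rewrite mulrC.
- pose M n : R := 64 * ln n%:R.
  have M0 n : (1 < n)%N -> 0 <= M n by move=> /ln2 h; rewrite mulr_ge0//; lra.
  apply: (@two_pass_Counters_size _ p M _ 70) => //.
  + by move=> n k /ln2 h; rewrite mulr_ge0//; lra.
  + move=> n k /ln2 h _; have := ler_wpM2l (ler0n R k) h; have := ler0n R k; lra.
  + exact: bound_eq.
  + move=> n k /ln2 h _; have := ler_wpM2l (ler0n R k) h; rewrite /M.
    have := ler0n R k; lra.
Qed.
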